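(* Let $n\ge1$ and let $\mathfrak S^n$ be the Siegel model of the Heisenberg group, with gauge metric $d$. For $\alpha>0$ and $h\in\mathfrak S^n$ consider the inequality $$d\big(h,(\vec p/q,r/q)\big)<|q|^{-\alpha},\qquad (\vec p/q,r/q)\in\mathfrak S^n(\mathbb{Q}),\ \vec p\in\mathbb{Z}[i]^n,\ r\in\mathbb{Z}[i],\ q\in\mathbb{Z}[i]\setminus\{0\}.\qquad( * )$$ If $\alpha=1$, then for almost every $h\in\mathfrak S^n$ there are infinitely many rational points $(\vec p/q,r/q)\in\mathfrak S^n(\mathbb{Q})$ satisfying $( * )$. If $\alpha>1$, then the set of $h\in\mathfrak S^n$ for which there are infinitely many rational points satisfying $( * )$ has measure zero.
   Context: The Siegel model is $\mathfrak S^n=\{(\vec u,v)\in\mathbb{C}^n\times\mathbb{C}: 2\,\mathrm{Re}(v)=|\vec u|^2\}$ with group law $(\vec u,v)*(\vec u',v')=(\vec u+\vec u',\,v+v'+\overline{\vec u}\cdot\vec u')$, where $\overline{\vec u}\cdot\vec u'=\sum_j\overline{u_j}u_j'$. The gauge metric is $d(h,h')=\|h^{-1}*h'\|$ with $\|(\vec u,v)\|=|v|^{1/2}$. $\mathfrak S^n(\mathbb{Q})=\mathfrak S^n\cap\mathbb{Q}[i]^{n+1}$. ''Almost every'' and ''measure'' refer to Haar measure on $\mathfrak S^n$ (Lebesgue measure in the coordinates $(\vec u,\mathrm{Im}\,v)\in\mathbb{C}^n\times\mathbb{R}$). *)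

(* Defs.v *)
From HB Require Import structures.
From mathcomp Require Import all_boot all_order all_algebra.
From mathcomp Require Import complex ring.
From mathcomp Require Import all_classical all_reals all_analysis.

Set Implicit Arguments.
Unset Strict Implicit.
Unset Printing Implicit Defensive.

Import Order.TTheory GRing.Theory Num.Theory.
Import numFieldNormedType.Exports.

Local Open Scope classical_set_scope.
Local Open Scope ring_scope.
Local Open Scope complex_scope.

(* The library proves that m1 \x m2 is sigma-finite, but on the head constant
   product_measure1 that canonical instance is shadowed by the one for
   subprobabilities; prod_measure is a fresh head constant for it. *)
Section ProductMeasure.
Context (d1 d2 : measure_display) (T1 : measurableType d1)
  (T2 : measurableType d2) (R : realType).
Variables (m1 : {sigma_finite_measure set T1 -> \bar R})
  (m2 : {sigma_finite_measure set T2 -> \bar R}).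

Definition prod_measure : set (T1 * T2) -> \bar R := (m1 \x m2)%E.

HB.instance Definition _ := Measure.on prod_measure.

Let prod_measure_sigma_finite : sigma_finite setT prod_measure.
Proof.
have /sigma_finiteP[F [TF ndF Foo]] := sigma_finiteT m1.
have /sigma_finiteP[G [TG ndG Goo]] := sigma_finiteT m2.
exists (fun k => F k `*` G k).
  rewrite -setXTT TF TG predeqE => -[x y]; split.
    move=> [/= [n _ Fnx] [k _ Gky]]; exists (maxn n k) => //; split.
    - by move: x Fnx; exact/subsetPset/ndF/leq_maxl.
    - by move: y Gky; exact/subsetPset/ndG/leq_maxr.
  by move=> [n _ []/= ? ?]; split; exists n.
move=> k; have [? ?] := Foo k; have [? ?] := Goo k.
split; first exact: measurableX.
by rewrite /prod_measure product_measure1E// lte_mul_pinfty// ge0_fin_numE.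
Qed.

HB.instance Definition _ := Measure_isSigmaFinite.Build _ _ _ prod_measure
  prod_measure_sigma_finite.

End ProductMeasure.

Section PowerMeasure.
Context (d : measure_display) (T : measurableType d) (R : realType).
Variable mu : {sigma_finite_measure set T -> \bar R}.

Definition cons_pair (n : nat) (x : T * n.-tuple T) : n.+1.-tuple T :=
  [the n.+1.-tuple T of x.1 :: x.2].

Lemma measurable_cons_pair (n : nat) (A : set (n.+1.-tuple T)) :
  measurable A -> measurable (@cons_pair n @^-1` A).
Proof.
move=> mA; rewrite -[X in measurable X]setTI.
by apply: (@measurable_cons _ _ _ _ fst n snd).
Qed.

Section PowerSucc.
Variables (n : nat) (nu : {sigma_finite_measure set (n.-tuple T) -> \bar R}).

Definition power_succ (A : set (n.+1.-tuple T)) : \bar R :=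
  prod_measure mu nu (@cons_pair n @^-1` A).

Let power_succ0 : power_succ set0 = 0%E.
Proof. by rewrite /power_succ preimage_set0 measure0. Qed.

Let power_succ_ge0 A : (0 <= power_succ A)%E.
Proof. exact: measure_ge0. Qed.

Let power_succ_sigma_additive : semi_sigma_additive power_succ.
Proof.
move=> F mF tF mUF; rewrite /power_succ preimage_bigcup.
apply: measure_semi_sigma_additive.
- by move=> k; exact: measurable_cons_pair.
- apply/trivIsetP => /= i j _ _ ij; rewrite -preimage_setI.
  by move/trivIsetP : tF => /(_ _ _ _ _ ij) ->//; rewrite preimage_set0.
- by rewrite -preimage_bigcup; exact: measurable_cons_pair.
Qed.

HB.instance Definition _ := isMeasure.Build _ _ _ power_succ
  power_succ0 power_succ_ge0 power_succ_sigma_additive.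

Let power_succ_sigma_finite : sigma_finite setT power_succ.
Proof.
have [F TF Foo] := sigma_finiteT (prod_measure mu nu).
pose uncons (t : n.+1.-tuple T) := (thead t, [tuple of behead t]).
have cK : cancel uncons (@cons_pair n).
  by move=> t; rewrite /uncons /cons_pair /= [RHS]tuple_eta; exact: val_inj.
have uK : cancel (@cons_pair n) uncons.
  by case=> x t; rewrite /uncons /cons_pair /=; congr (_, _); exact: val_inj.
have mu_uncons : measurable_fun setT uncons.
  apply/measurable_fun_pairP; split => /=.
    exact: (measurable_tnth ord0).
  exact: measurable_behead.
exists (fun k => uncons @^-1` F k).
  by rewrite -preimage_bigcup -TF preimage_setT.
move=> k; have [mFk Fkoo] := Foo k; split.
  by rewrite -[X in measurable X]setTI; exact: mu_uncons.
rewrite /power_succ -comp_preimage (_ : uncons \o _ = id)//.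
by apply/funext => x /=; rewrite uK.
Qed.

HB.instance Definition _ := Measure_isSigmaFinite.Build _ _ _ power_succ
  power_succ_sigma_finite.

End PowerSucc.

Fixpoint power_measure (n : nat) :
    {sigma_finite_measure set (n.-tuple T) -> \bar R} :=
  match n with
  | 0%N => [the {sigma_finite_measure set (0.-tuple T) -> \bar R}
              of \d_ [tuple]]
  | n'.+1 => [the {sigma_finite_measure set (n'.+1.-tuple T) -> \bar R}
              of power_succ (power_measure n')]
  end.

Lemma power_measure_box (n : nat) (A : 'I_n -> set T) :
  (forall i, measurable (A i)) ->
  power_measure n [set t | forall i, A i (tnth t i)] = (\prod_i mu (A i))%E.
Proof.
elim: n A => [|n IH] A mA /=.
  by rewrite big_ord0 diracE mem_set// => -[].
have mB : measurable [set t : n.-tuple T | forall i, A (lift ord0 i) (tnth t i)].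
  rewrite (_ : [set _ | _] =
    \bigcap_(i in [set: 'I_n]) ((@tnth _ T)^~ i @^-1` A (lift ord0 i))).
    apply: fin_bigcap_measurable => // i _; rewrite -[X in measurable X]setTI.
    exact: measurable_tnth.
  by apply/seteqP; split => [t tA i _|t tA i] /=; [exact: tA|exact: (tA i)].
rewrite big_ord_recl -(IH (fun i => A (lift ord0 i)))// /power_succ.
rewrite -product_measure1E//; congr product_measure1.
apply/seteqP; split => -[x t] /=.
  move=> xtA; split; first exact: (xtA ord0).
  by move=> i; have := xtA (lift ord0 i); rewrite tnthS.
move=> [xA tA] i; case: (unliftP ord0 i) => [j ->|->//].
by rewrite tnthS; exact: tA.
Qed.

End PowerMeasure.

(* R[i]'s generic norm is R[i]-valued; cmod is the R-valued modulus. *)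
Notation cmod := ComplexField.Normc.normc.

Section Siegel.
Context (R : realType) (n : nat).
(* Ambient space of the Siegel model; siegel below is the model itself. *)
Local Notation point := ('rV[R[i]]_n * R[i])%type.
Implicit Types (u : 'rV[R[i]]_n) (v : R[i]) (h : point).

Definition sqnorm u : R := \sum_j cmod (u 0 j) ^+ 2.

Definition hdot u u' : R[i] := \sum_j conjc (u 0 j) * u' 0 j.

Definition siegel : set point := [set h | 2 * complex.Re h.2 = sqnorm h.1].

Definition siegel_mul h h' : point := (h.1 + h'.1, h.2 + h'.2 + hdot h.1 h'.1).

Definition siegel_inv h : point := (- h.1, conjc h.2).

Definition gauge h : R := Num.sqrt (cmod h.2).

Definition gauge_dist h h' : R := gauge (siegel_mul (siegel_inv h) h').

Lemma cmod_sqr (z : R[i]) :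
  cmod z ^+ 2 = complex.Re z ^+ 2 + complex.Im z ^+ 2.
Proof. by case: z => a b /=; rewrite sqr_sqrtr// addr_ge0 ?sqr_ge0. Qed.

Lemma hdotuu u : hdot u u = (sqnorm u)%:C.
Proof.
rewrite /hdot /sqnorm rmorph_sum; apply: eq_bigr => j _.
rewrite cmod_sqr; case: (u 0 j) => a b /=.
by apply/eqP; rewrite eq_complex /= !expr2; apply/andP; split; apply/eqP; ring.
Qed.

Lemma siegel_mulP h h' : siegel h -> siegel h' -> siegel (siegel_mul h h').
Proof.
rewrite /siegel /= => hS h'S.
rewrite !raddfD /= !mulrDr hS h'S /hdot raddf_sum mulr_sumr /sqnorm.
rewrite -!big_split; apply: eq_bigr => j _ /=; rewrite !mxE !cmod_sqr.
by case: (h.1 0 j) => a b; case: (h'.1 0 j) => a' b' /=; ring.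
Qed.

Lemma siegel_invP h : siegel h -> siegel (siegel_inv h).
Proof.
rewrite /siegel /= => hS.
transitivity (sqnorm h.1); first by rewrite -hS; case: (h.2).
apply: eq_bigr => j _; rewrite !mxE !cmod_sqr.
by case: (h.1 0 j) => a b /=; ring.
Qed.

Lemma siegel_mulV h : siegel h -> siegel_mul h (siegel_inv h) = (0, 0).
Proof.
rewrite /siegel /= => hS; rewrite /siegel_mul /= subrr; congr (_, _).
have -> : hdot h.1 (- h.1) = - hdot h.1 h.1.
  by rewrite /hdot -sumrN; apply: eq_bigr => j _; rewrite !mxE mulrN.
rewrite hdotuu -hS; case: (h.2) => a b /=.
by apply/eqP; rewrite eq_complex /=; apply/andP; split; apply/eqP; ring.
Qed.

Lemma siegel_mulVl h : siegel h -> siegel_mul (siegel_inv h) h = (0, 0).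
Proof.
rewrite /siegel /= => hS; rewrite /siegel_mul /= addNr; congr (_, _).
have -> : hdot (- h.1) h.1 = - hdot h.1 h.1.
  rewrite /hdot -sumrN; apply: eq_bigr => j _.
  by rewrite !mxE rmorphN mulNr.
rewrite hdotuu -hS; case: (h.2) => a b /=.
by apply/eqP; rewrite eq_complex /=; apply/andP; split; apply/eqP; ring.
Qed.

Definition gaussian_int : set R[i] :=
  [set z | exists a b : int, z = (a%:~R : R) +i* (b%:~R : R)].

Definition gaussian_rat : set R[i] :=
  [set z | exists a b : rat, z = (ratr a : R) +i* (ratr b : R)].

Definition siegelQ : set point :=
  [set h | [/\ siegel h, forall j, gaussian_rat (h.1 0 j) & gaussian_rat h.2]].

(* The solutions are counted as points of the group: different fractions
   (p / q, r / q) of the same point are not distinguished. *)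
Definition approximants (alpha : R) h : set point :=
  [set x | siegelQ x /\
    exists (p : 'rV[R[i]]_n) (r q : R[i]),
      [/\ forall j, gaussian_int (p 0 j), gaussian_int r,
          gaussian_int q /\ q != 0,
          x = (q^-1 *: p, r / q) &
          gauge_dist h x < cmod q `^ (- alpha)]].

Definition lebesgueC :
    {sigma_finite_measure set (measurableTypeR R * measurableTypeR R)%type
      -> \bar R} :=
  prod_measure (@lebesgue_measure R) (@lebesgue_measure R).

(* A point of C^n x R, complex numbers being given by their real and imaginary
   parts. *)
Local Notation coords :=
  (n.-tuple (measurableTypeR R * measurableTypeR R) * measurableTypeR R)%type.

Definition chart_u (x : coords) : 'rV[R[i]]_n :=
  \row_j ((tnth x.1 j).1 +i* (tnth x.1 j).2).

(* The point of the Siegel model with coordinates (u, Im v). *)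
Definition chart (x : coords) : point :=
  (chart_u x, (sqnorm (chart_u x) / 2) +i* x.2).

Lemma chart_siegel (x : coords) : siegel (chart x).
Proof. by rewrite /siegel /=; field. Qed.

Lemma chart_inj : injective chart.
Proof.
move=> [s a] [t b] [/rowP st _ ->]; congr (_, _).
apply: eq_from_tnth => j; have := st j; rewrite !mxE /=.
by case: (tnth s j) (tnth t j) => [? ?] [? ?] /= [-> ->].
Qed.

Lemma chart_surj h : siegel h -> exists x, chart x = h.
Proof.
case: h => u [a b]; rewrite /siegel /= => hS.
exists ([tuple (complex.Re (u 0 j), complex.Im (u 0 j)) | j < n], b).
have -> : chart ([tuple (complex.Re (u 0 j), complex.Im (u 0 j)) | j < n], b)
    = (u, (sqnorm u / 2) +i* b).
  have uE : chart_u ([tuple (complex.Re (u 0 j), complex.Im (u 0 j)) | j < n], b)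
      = u.
    by apply/rowP => j; rewrite mxE /= tnth_mktuple /=; case: (u 0 j).
  by rewrite /chart uE.
by congr (_, _ +i* _); rewrite -hS; field.
Qed.

(* Haar measure of the Siegel model, in the coordinates (u, Im v). *)
Definition haar : {sigma_finite_measure set coords -> \bar R} :=
  prod_measure (power_measure lebesgueC n) (@lebesgue_measure R).

Definition haar_null (E : set point) : Prop :=
  haar.-negligible (chart @^-1` E).

Definition haar_ae (P : point -> Prop) : Prop :=
  haar_null [set h | siegel h /\ ~ P h].

End Siegel.

(* Main.v *)
(** Clearing denominators in x^-1 * y shows that two distinct rational points
    with denominators q and q' have squared gauge distance at least
    1 / (|q| |q'|), while a ball of squared radius t has measure comparable to
    t^(n+1). So a bounded region contains O(Q^(2n+2)) rational points of
    denominator at most Q, and for alpha > 1 the first Borel-Cantelli lemma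
    over dyadic ranges of |q| concludes.
    For alpha = 1, a Bezout construction with q = a + ib, a and b coprime, gives
    a matching lower bound for the number of rational points, and separation
    makes the balls of squared radius eta / Q^2 around them quasi-independent
    along a sparse sequence of scales Q. Bonferroni's inequality then bounds the
    measure of the points within eps / Q^2 of a rational point of denominator at
    most Q from below, uniformly in eps, so that the points for which this
    happens for every eps form a set of positive measure. This set is invariant
    under left translation by rational points, hence of full measure by
    Lebesgue's density theorem applied one real coordinate at a time. A point of
    this set with irrational vertical coordinate is not rational, so that letting
    eps tend to 0 yields infinitely many approximants. *)
Require Import Defs.
From mathcomp Require Import all_boot all_order all_algebra.
From mathcomp Require Import finmap complex ring lra zify.
From mathcomp Require Import all_classical all_reals all_analysis.
From mathcomp Require Import measurable_realfun.

Set Implicit Arguments.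
Unset Strict Implicit.
Unset Printing Implicit Defensive.

Import Order.TTheory GRing.Theory Num.Theory.
Import numFieldNormedType.Exports.

Local Open Scope classical_set_scope.
Local Open Scope ring_scope.
Local Open Scope complex_scope.

(** * A zero-one law on the line from Lebesgue's density theorem *)

Lemma lebesgue_measure_translation (R : realType) (t : R) (A : set R) :
  measurable A ->
  lebesgue_measure ((fun x => x + t) @^-1` A) = lebesgue_measure A.
Proof.
move=> mA.
have mf : measurable_fun [set: measurableTypeR R]
    ((fun x => x + t) : _ -> measurableTypeR R).
  exact: measurable_funD.
transitivity (pushforward lebesgue_measure
  ((fun x => x + t) : measurableTypeR R -> measurableTypeR R) A) => //.
apply/esym/lebesgue_measure_unique => //=.
move=> _ [[a b]] _ <-; rewrite /pushforward /=.
rewrite (_ : _ @^-1` _ = `]a - t, b - t]%classic).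
  rewrite !lebesgue_measure_itv/= !lte_fin ltrD2r -!EFinD.
  by rewrite (_ : b - t - (a - t) = b - a)//; ring.
by apply/seteqP; split => x /=; rewrite !in_itv/= ltrBlDr lerBrDr.
Qed.

(** Otherwise take density points [a] of [A] and [b] of its complement. A rational translation
    brings [b] close to [a], and invariance then puts two disjoint sets, each filling 7/8 of an
    interval of length 2r, inside one interval of length 3r, which is impossible. *)
Lemma translation_zero_one (R : realType) (A : set R) : measurable A ->
  (forall (M : nat) (a : int), (0 < M)%N ->
     forall x, A x -> A (x + a%:~R / M%:R)) ->
  lebesgue_measure A = 0%E \/ lebesgue_measure (~` A) = 0%E.
Proof.
set mu := @lebesgue_measure R.
move=> mA tA; apply: contrapT => /not_orP[A0 cA0].
have dens (B : set R) : measurable B -> mu B <> 0%E -> exists2 b, B b &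
    \forall r \near 0^'+, ((7 / 4 * r)%:E <= mu (B `&` ball b r))%E.
  move=> mB B0; have /= dB := @lebesgue_density R _ mB.
  have [b [Bb hb]] : exists b, B b /\ (mu (B `&` ball b r) * (mu (ball b r))^-1)%E
      @[r --> 0^'+] --> (\1_B b)%:E.
    apply: contrapT => /forallNP nB; apply: B0.
    apply: (@measure_negligible _ _ _ (@lebesgue_measure R) B) => //; apply: negligibleS dB => b Bb /= hb.
    by apply: (nB b).
  exists b => //; rewrite indicE mem_set//= in hb.
  have /hb : nbhs (1%:E : \bar R) [set y | ((7 / 8 : R)%:E < y)%E].
    apply: open_nbhs_nbhs; split; first exact: open_ereal_gt_ereal.
    by rewrite /= lte_fin; lra.
  rewrite /= nbhs_simpl => {}hb; near=> r.
  have r0 : 0 < r by near: r; exact: nbhs_right_gt.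
  have /= : ((7 / 8 : R)%:E < (mu (B `&` ball b r) * (mu (ball b r))^-1)%E)%E.
    by near: r.
  rewrite /mu lebesgue_measure_ball; last exact: ltW. rewrite inver mulrn_eq0/= gt_eqF// => h.
  apply: ltW; rewrite (_ : 7 / 4 * r = 7 / 8 * (r *+ 2)); last by field.
  by rewrite EFinM -lte_pdivlMr// ?mulrn_wgt0// pmulrn_lgt0.
have [a Aa ha] := dens _ mA A0.
have [b Bb hb] := dens _ (measurableC mA) cA0.
have [r [/andP[har hbr] r0]] : exists r : R,
    ((7 / 4 * r)%:E <= mu (A `&` ball a r))%E &&
    ((7 / 4 * r)%:E <= mu (~` A `&` ball b r))%E /\ 0 < r.
  near (0 : R)^'+ => r; exists r; split; last by near: r; exact: nbhs_right_gt.
  by apply/andP; split; near: r.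
(* The mesh 1/M is below r/2, so rounding [a - b] down to a multiple of 1/M is accurate enough. *)
have [M [z [M0 hz]]] : exists (M : nat) (z : int), (0 < M)%N /\
    `|b + z%:~R / M%:R - a| < r / 2.
  have r20 : 0 < r / 2 by lra.
  pose M := (Num.truncn (2 / r)).+1.
  have M0 : 0 < M%:R :> R by rewrite ltr0n.
  have MR : 2 / r < M%:R by rewrite /M truncnS_gt.
  exists M, (Num.floor ((a - b) * M%:R)); split => //.
  have /andP[h1 h2] := floor_itv ((a - b) * M%:R).
  have h3 : (Num.floor ((a - b) * M%:R))%:~R / M%:R <= a - b.
    by rewrite ler_pdivrMr.
  have h4 : a - b < (Num.floor ((a - b) * M%:R))%:~R / M%:R + M%:R^-1.
    rewrite -(ltr_pM2r M0) [X in _ < X]mulrDl mulVf ?gt_eqF// divfK ?gt_eqF//.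
    by move: h2; rewrite rmorphD.
  have h5 : M%:R^-1 < r / 2.
    rewrite invf_plt ?posrE//; suff -> : (r / 2)^-1 = 2 / r by [].
    by rewrite invfM invrK mulrC.
  by rewrite ltr_norml; lra.
set t := z%:~R / M%:R in hz.
pose B := ~` A `&` ball (b + t) r.
(* Invariance of [A] under both [z] and [- z] makes its complement invariant as well. *)
have shB : (~` A `&` ball b r) = (fun x => x + t) @^-1` B.
  apply/seteqP; split => x /= [nAx]; rewrite /B /= /ball /= => xr; split.
  - move=> /(tA _ (- z) M0); rewrite rmorphN mulNr -/t addrK; exact: nAx.
  - by rewrite opprD addrACA subrr addr0.
  - by move=> /(tA _ z M0); rewrite -/t.
  - by move: xr; rewrite opprD addrACA subrr addr0.
have mB : measurable B by apply: measurableI; [exact: measurableC|exact: measurable_ball].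
have muB : mu B = mu (~` A `&` ball b r).
  by rewrite shB [RHS]lebesgue_measure_translation.
have hsub : (A `&` ball a r) `|` B `<=` ball a (3 / 2 * r).
  move=> x [[_]|[_]]; rewrite /ball /= => /[!ltr_norml]; first lra.
  by move: hz; rewrite ltr_norml; lra.
have mAb : measurable (A `&` ball a r).
  by apply: measurableI => //; exact: measurable_ball.
have mb : measurable (ball a (3 / 2 * r)) by exact: measurable_ball.
have /= := le_measure mu (mem_set (measurableU _ _ mAb mB)) (mem_set mb) hsub.
rewrite measureU//; last first.
  by apply/seteqP; split => // x [[Ax _] [nAx _]].
rewrite lebesgue_measure_ball; last lra.
move=> hle.
have := le_trans (leeD har hbr) _.
rewrite -muB => /(_ _ hle); rewrite -EFinD lee_fin; lra.
Unshelve. all: by end_near. Qed.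

(** * Zero-one laws in product spaces by Fubini's theorem *)

Section ProductZeroOne.
Context (d1 d2 : measure_display) (T1 : measurableType d1)
  (T2 : measurableType d2) (R : realType).
Variables (m1 : {sigma_finite_measure set T1 -> \bar R})
  (m2 : {sigma_finite_measure set T2 -> \bar R}).

Lemma measurable_null_xsection (A : set (T1 * T2)) : measurable A ->
  measurable [set x | m2 (xsection A x) = 0%E].
Proof.
move=> mA; rewrite -[X in measurable X]setTI.
exact: (measurable_fun_xsection m2 mA measurableT (emeasurable_set1 0%E)).
Qed.

Lemma prod_measure_eq0 (A : set (T1 * T2)) : measurable A ->
  m1 (~` [set x | m2 (xsection A x) = 0%E]) = 0%E ->
  prod_measure m1 m2 A = 0%E.
Proof.
move=> mA A0; rewrite /prod_measure /product_measure1.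
transitivity (\int[m1]_x (cst 0%E : T1 -> \bar R) x)%E; last exact: integral0.
apply: ae_eq_integral => //; first exact: measurable_fun_xsection.
exists (~` [set x | m2 (xsection A x) = 0%E]); split => //.
  exact/measurableC/measurable_null_xsection.
by move=> x /= /not_implyP[_]; exact.
Qed.

Lemma xsectionC (A : set (T1 * T2)) x : xsection (~` A) x = ~` xsection A x.
Proof. by rewrite !xsectionE. Qed.

(** Either [A] or its complement has almost all sections null. This allows a zero-one law to be
    proved one coordinate at a time. *)
Lemma prod_measure_zero_one (A : set (T1 * T2)) : measurable A ->
  (forall x, m2 (xsection A x) = 0%E \/ m2 (~` xsection A x) = 0%E) ->
  m1 [set x | m2 (xsection A x) = 0%E] = 0%E \/
  m1 (~` [set x | m2 (xsection A x) = 0%E]) = 0%E ->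
  prod_measure m1 m2 A = 0%E \/ prod_measure m1 m2 (~` A) = 0%E.
Proof.
move=> mA h [P0|P0]; last by left; exact: prod_measure_eq0.
right; apply: prod_measure_eq0; first exact: measurableC.
apply: (subset_measure0 _ _ _ P0).
- exact/measurableC/measurable_null_xsection/measurableC.
- exact: measurable_null_xsection.
- by move=> x /=; rewrite xsectionC; case: (h x).
Qed.

End ProductZeroOne.

(** * Zero-one laws for sets of tuples invariant under rational shifts *)

Section GridZeroOne.
Context (R : realType).
Local Notation plane := (measurableTypeR R * measurableTypeR R)%type.

(** A common denominator [M] is imposed on all coordinates, so that one integer clears the group
    translation that will realize the shift. *)
Definition grid_shift (M : nat) (a : int * int) (z : plane) : plane :=
  (z.1 + a.1%:~R / M%:R, z.2 + a.2%:~R / M%:R).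

Lemma grid_shift0 M z : grid_shift M (0, 0) z = z.
Proof. by case: z => x y; rewrite /grid_shift /= mul0r !addr0. Qed.

Lemma plane_zero_one (A : set plane) : measurable A ->
  (forall M a, (0 < M)%N -> forall z, A z -> A (grid_shift M a z)) ->
  lebesgueC R A = 0%E \/ lebesgueC R (~` A) = 0%E.
Proof.
move=> mA tA; apply: prod_measure_zero_one => //.
- move=> x; apply: translation_zero_one; first exact: measurable_xsection.
  move=> M a M0 y; rewrite xsectionE /= => /(tA M (0, a) M0).
  by rewrite /grid_shift /= mul0r addr0.
- apply: translation_zero_one; first exact: measurable_null_xsection.
  move=> M a M0 x /= <-; congr (lebesgue_measure _).
  (* The sections over [x] and over its translate coincide, as the shifts by [a] and [- a] show. *)
  apply/seteqP; split=> y; rewrite !xsectionE /=.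
  + move=> /(tA M (- a, 0) M0); rewrite /grid_shift /= mul0r addr0.
    by rewrite rmorphN mulNr addrK.
  + by move=> /(tA M (a, 0) M0); rewrite /grid_shift /= mul0r addr0.
Qed.

Definition tuple_shift n M (a : n.-tuple (int * int)) (s : n.-tuple plane) :
  n.-tuple plane := [tuple grid_shift M (tnth a i) (tnth s i) | i < n].

Lemma cons_tuple_shift n M a (b : n.-tuple (int * int)) (x : plane * n.-tuple plane) :
  cons_pair (grid_shift M a x.1, tuple_shift M b x.2) =
  tuple_shift M [tuple of a :: b] (cons_pair x).
Proof.
apply: eq_from_tnth => i; rewrite tnth_mktuple.
by case: (unliftP ord0 i) => [j|] ->; rewrite ?tnthS ?tnth0 // tnth_mktuple.
Qed.

(** Induction on the number of coordinates: shifts of the tail alone act on each section, and shifts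
    of the head alone leave the sections unchanged. *)
Lemma power_zero_one n (A : set (n.-tuple plane)) : measurable A ->
  (forall M a, (0 < M)%N -> forall s, A s -> A (tuple_shift M a s)) ->
  power_measure (lebesgueC R) n A = 0%E \/
  power_measure (lebesgueC R) n (~` A) = 0%E.
Proof.
elim: n A => [|n IH] A mA tA.
  rewrite /= !diracE; case: (asboolP (A [tuple])) => h.
    by right; rewrite memNset.
  by left; rewrite memNset.
have shift0 (s : n.-tuple plane) M :
    tuple_shift M [tuple (0, 0) | _ < n] s = s.
  apply: eq_from_tnth => i; rewrite !tnth_mktuple; exact: grid_shift0.
apply: prod_measure_zero_one; first exact: measurable_cons_pair.
- move=> z; apply: IH.
    by apply: measurable_xsection; exact: measurable_cons_pair.
  move=> M a M0 s; rewrite !xsectionE /= => /(tA M [tuple of (0, 0) :: a] M0).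
  by rewrite -cons_tuple_shift /= grid_shift0.
- apply: plane_zero_one.
    by apply: measurable_null_xsection; exact: measurable_cons_pair.
  move=> M a M0 z /= <-; congr (power_measure _ _ _).
  apply/seteqP; split=> s; rewrite !xsectionE /=.
  + move=> /(tA M [tuple of (- a.1, - a.2) :: [tuple (0, 0) | _ < n]] M0).
    rewrite -cons_tuple_shift /= shift0 /grid_shift /=.
    by rewrite !rmorphN !mulNr !addrK; case: z.
  + move=> /(tA M [tuple of a :: [tuple (0, 0) | _ < n]] M0).
    by rewrite -cons_tuple_shift /= shift0.
Qed.

End GridZeroOne.

(** * The real-valued modulus of complex numbers *)

Section ComplexModulus.
Context (R : realType).
Implicit Types z w : R[i].

Lemma cmodE z : cmod z = Num.sqrt (complex.Re z ^+ 2 + complex.Im z ^+ 2).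
Proof. by case: z. Qed.

Lemma cmod_ge0 z : 0 <= cmod z.
Proof. by rewrite cmodE sqrtr_ge0. Qed.

Lemma cmodD z w : cmod (z + w) <= cmod z + cmod w.
Proof. exact: le_normcD. Qed.

Lemma cmodM z w : cmod (z * w) = cmod z * cmod w.
Proof. exact: ComplexField.Normc.normcM. Qed.

Lemma cmod_conj z : cmod (conjc z) = cmod z.
Proof. by case: z => a b; rewrite /= sqrrN. Qed.

Lemma cmod_eq0 z : (cmod z == 0) = (z == 0).
Proof.
apply/eqP/eqP => [/ComplexField.Normc.eq0_normc//|->].
by rewrite ComplexField.Normc.normc0.
Qed.

Lemma le_cmod (c : R) z : 0 <= c ->
  (cmod z <= c) = (complex.Re z ^+ 2 + complex.Im z ^+ 2 <= c ^+ 2).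
Proof.
by move=> c0; rewrite -[LHS](ler_sqr (cmod_ge0 z)) ?nnegrE// cmod_sqr.
Qed.

Lemma lt_cmod (c : R) z : 0 <= c ->
  (cmod z < c) = (complex.Re z ^+ 2 + complex.Im z ^+ 2 < c ^+ 2).
Proof.
by move=> c0; rewrite -[LHS](ltr_sqr (cmod_ge0 z)) ?nnegrE// cmod_sqr.
Qed.

Lemma normr_Re_cmod z : `|complex.Re z| <= cmod z.
Proof.
rewrite -[X in X <= _]ger0_norm// -ler_sqr ?nnegrE ?cmod_ge0// cmod_sqr.
by rewrite normr_id real_normK ?num_real// lerDl sqr_ge0.
Qed.

Lemma normr_Im_cmod z : `|complex.Im z| <= cmod z.
Proof.
rewrite -[X in X <= _]ger0_norm// -ler_sqr ?nnegrE ?cmod_ge0// cmod_sqr.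
by rewrite normr_id real_normK ?num_real// lerDr sqr_ge0.
Qed.

Lemma cmod_sum (I : finType) (F : I -> R[i]) :
  cmod (\sum_i F i) <= \sum_i cmod (F i).
Proof.
elim/big_ind2 : _ => // [|x a y b xa yb]; first by rewrite ComplexField.Normc.normc0.
exact: (le_trans (cmodD _ _) (lerD xa yb)).
Qed.

End ComplexModulus.

(** * The group law and the quasi-subadditivity of the squared gauge *)

Section SiegelGroup.
Context (R : realType) (n : nat).
Local Notation point := ('rV[R[i]]_n * R[i])%type.
Implicit Types g h k : point.

Lemma hdotDl (a b c : 'rV[R[i]]_n) : hdot (a + b) c = hdot a c + hdot b c.
Proof.
by rewrite /hdot -big_split; apply: eq_bigr => j _; rewrite mxE rmorphD mulrDl.
Qed.

Lemma hdotDr (a b c : 'rV[R[i]]_n) : hdot a (b + c) = hdot a b + hdot a c.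
Proof.
by rewrite /hdot -big_split; apply: eq_bigr => j _; rewrite mxE mulrDr.
Qed.

Lemma hdotNl (a b : 'rV[R[i]]_n) : hdot (- a) b = - hdot a b.
Proof.
by rewrite /hdot -sumrN; apply: eq_bigr => j _; rewrite mxE rmorphN mulNr.
Qed.

Lemma siegel_mulA g h k :
  siegel_mul g (siegel_mul h k) = siegel_mul (siegel_mul g h) k.
Proof.
rewrite /siegel_mul /= addrA hdotDl hdotDr; congr (_, _); ring.
Qed.

Lemma siegel_mul0l h : siegel_mul (0, 0) h = h.
Proof.
case: h => u v; rewrite /siegel_mul /= !add0r (_ : hdot 0 u = 0) ?addr0//.
by rewrite /hdot big1// => j _; rewrite mxE conjc0 mul0r.
Qed.

Lemma sqnorm_le g : siegel g -> sqnorm g.1 <= 2 * cmod g.2.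
Proof.
move=> <-; rewrite ler_pM2l//; apply: le_trans (normr_Re_cmod _).
exact: ler_norm.
Qed.

(* The arithmetic-geometric mean inequality bounds the hermitian product by
   the half-sum of the squared norms. *)
Lemma cmod_siegel_mul g h : siegel g -> siegel h ->
  cmod (siegel_mul g h).2 <= 2 * (cmod g.2 + cmod h.2).
Proof.
move=> Sg Sh; have gh : cmod (hdot g.1 h.1) <= cmod g.2 + cmod h.2.
  have : cmod (hdot g.1 h.1) <= (sqnorm g.1 + sqnorm h.1) / 2.
    rewrite /sqnorm -big_split mulr_suml; apply: le_trans (cmod_sum _) _.
    apply: ler_sum => j _; rewrite cmodM cmod_conj /=.
    have := sqr_ge0 (cmod (g.1 0 j) - cmod (h.1 0 j)); rewrite sqrrB; lra.
  have := sqnorm_le Sg; have := sqnorm_le Sh; lra.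
rewrite /siegel_mul /=; have := cmodD (g.2 + h.2) (hdot g.1 h.1).
have := cmodD g.2 h.2; lra.
Qed.

End SiegelGroup.

(** * The squared gauge distance and left translations in real coordinates *)

Section GaugeSquare.
Context (R : realType) (n : nat).
Local Notation coords :=
  (n.-tuple (measurableTypeR R * measurableTypeR R) * measurableTypeR R)%type.
Implicit Types x y z h : coords.

Definition horiz x h : R :=
  \sum_j (((tnth h.1 j).1 - (tnth x.1 j).1) ^+ 2 +
          ((tnth h.1 j).2 - (tnth x.1 j).2) ^+ 2).

(** The standard symplectic form, that is, the imaginary part of [hdot]. *)
Definition symp (s t : n.-tuple (measurableTypeR R * measurableTypeR R)) : R :=
  \sum_j ((tnth s j).1 * (tnth t j).2 - (tnth s j).2 * (tnth t j).1).

Definition vert x h : R := h.2 - x.2 - symp x.1 h.1.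

(** The square of the gauge distance: it is the modulus of one complex coordinate, which clearing
    denominators turns into a Gaussian integer. *)
Definition gauge2 x h : R :=
  cmod (siegel_mul (siegel_inv (chart x)) (chart h)).2.

Lemma gauge_dist_chart x h : gauge_dist (chart x) (chart h) = Num.sqrt (gauge2 x h).
Proof. by []. Qed.

Lemma sqnorm_chart_u h :
  sqnorm (chart_u h) = \sum_j ((tnth h.1 j).1 ^+ 2 + (tnth h.1 j).2 ^+ 2).
Proof. by apply: eq_bigr => j _; rewrite mxE cmod_sqr. Qed.

Lemma siegel_diff x h : siegel (siegel_mul (siegel_inv (chart x)) (chart h)).
Proof.
by apply: siegel_mulP; [apply: siegel_invP|]; exact: chart_siegel.
Qed.

Lemma Re_diff x h :
  complex.Re (siegel_mul (siegel_inv (chart x)) (chart h)).2 = horiz x h / 2.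
Proof.
rewrite -[LHS](mulKf (_ : 2 != 0))// (siegel_diff x h) mulrC; congr (_ / _).
apply: eq_bigr => j _; rewrite /= !mxE cmod_sqr /=.
by congr (_ ^+ 2 + _ ^+ 2); rewrite addrC.
Qed.

Lemma Im_diff x h :
  complex.Im (siegel_mul (siegel_inv (chart x)) (chart h)).2 = vert x h.
Proof.
rewrite /siegel_mul /siegel_inv /= hdotNl /hdot /vert /symp.
rewrite raddfD raddfN raddf_sum /= [- _ + _]addrC; congr (_ - _).
apply: eq_bigr => j _; rewrite !mxE /=; ring.
Qed.

Lemma gauge2E x h : gauge2 x h = Num.sqrt ((horiz x h / 2) ^+ 2 + vert x h ^+ 2).
Proof. by rewrite /gauge2 cmodE Re_diff Im_diff. Qed.

Lemma gauge2_ge0 x h : 0 <= gauge2 x h.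
Proof. exact: cmod_ge0. Qed.

Lemma horiz_ge0 x h : 0 <= horiz x h.
Proof. by apply: sumr_ge0 => j _; rewrite addr_ge0// sqr_ge0. Qed.

Lemma horiz_gauge2 x h : horiz x h <= 2 * gauge2 x h.
Proof.
have := normr_Re_cmod (siegel_mul (siegel_inv (chart x)) (chart h)).2.
rewrite Re_diff -/(gauge2 x h) => /(le_trans (ler_norm _)); lra.
Qed.

Lemma vert_gauge2 x h : `|vert x h| <= gauge2 x h.
Proof. by rewrite -Im_diff normr_Im_cmod. Qed.

Lemma gauge2_sym x h : gauge2 x h = gauge2 h x.
Proof.
rewrite !gauge2E; congr (Num.sqrt ((_ / 2) ^+ 2 + _)).
  by apply: eq_bigr => j _; congr (_ + _); rewrite -sqrrN opprB.
rewrite -sqrrN; congr (_ ^+ 2); rewrite /vert !opprD !opprK.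
rewrite [- h.2 + x.2]addrC; congr (_ + _).
rewrite /symp -sumrN; apply: eq_bigr => j _; ring.
Qed.

(** Inserting [y * y^-1] writes [x^-1 * z] as a product, to which [cmod_siegel_mul] applies. *)
Lemma gauge2_tri y x z : gauge2 x z <= 2 * (gauge2 x y + gauge2 y z).
Proof.
rewrite /gauge2 -{1}(siegel_mul0l (chart z)) -(siegel_mulV (chart_siegel y)).
rewrite -siegel_mulA siegel_mulA; apply: cmod_siegel_mul; exact: siegel_diff.
Qed.

Lemma gauge2_eq0 x h : gauge2 x h = 0 -> x = h.
Proof.
move=> xh0; have h0 : horiz x h = 0.
  by apply/eqP; rewrite eq_le horiz_ge0 andbT (le_trans (horiz_gauge2 _ _))// xh0 mulr0.
have v0 : vert x h = 0.
  by apply/normr0_eq0/eqP; rewrite eq_le normr_ge0 andbT -xh0 vert_gauge2.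
have e1 : x.1 = h.1.
  apply: eq_from_tnth => j; move/eqP: h0; rewrite psumr_eq0; last first.
    by move=> i _; rewrite addr_ge0// sqr_ge0.
  move=> /allP/(_ j (mem_index_enum j)) /=; rewrite paddr_eq0 ?sqr_ge0//.
  rewrite !sqrf_eq0 !subr_eq0 => /andP[/eqP h1 /eqP h2].
  by case: (tnth x.1 j) (tnth h.1 j) h1 h2 => [a b] [c d] /= -> ->.
have s0 : symp x.1 x.1 = 0 by rewrite /symp big1// => j _; rewrite mulrC subrr.
move: v0; rewrite /vert -e1 s0 subr0 => /eqP; rewrite subr_eq0 => /eqP e2.
by case: x h e1 e2 {xh0 h0 s0} => [? ?] [? ?] /= -> ->.
Qed.

(** Left multiplication by [g] read through [chart]; see [chart_ltrans]. *)
Definition ltrans (g h : coords) : coords :=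
  ([tuple ((tnth g.1 j).1 + (tnth h.1 j).1, (tnth g.1 j).2 + (tnth h.1 j).2) | j < n],
   g.2 + h.2 + symp g.1 h.1).

Lemma horiz_ltrans g x h : horiz (ltrans g x) (ltrans g h) = horiz x h.
Proof. by apply: eq_bigr => j _; rewrite !tnth_mktuple /=; congr (_ ^+ 2 + _ ^+ 2); ring. Qed.

Lemma vert_ltrans g x h : vert (ltrans g x) (ltrans g h) = vert x h.
Proof.
rewrite /vert /ltrans /= [in X in _ - X]/symp.
under eq_bigr do rewrite !tnth_mktuple /=.
have -> : \sum_(i < n) (((tnth g.1 i).1 + (tnth x.1 i).1) * ((tnth g.1 i).2 + (tnth h.1 i).2) -
    ((tnth g.1 i).2 + (tnth x.1 i).2) * ((tnth g.1 i).1 + (tnth h.1 i).1)) =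
    symp g.1 h.1 - symp g.1 x.1 + symp x.1 h.1.
  rewrite /symp -sumrB -big_split; apply: eq_bigr => j _ /=; ring.
ring.
Qed.

Lemma gauge2_ltrans g x h : gauge2 (ltrans g x) (ltrans g h) = gauge2 x h.
Proof. by rewrite !gauge2E horiz_ltrans vert_ltrans. Qed.

Lemma chart_ltrans g h : chart (ltrans g h) = siegel_mul (chart g) (chart h).
Proof.
have e1 : chart_u (ltrans g h) = chart_u g + chart_u h.
  by apply/rowP => j; rewrite !mxE tnth_mktuple.
have S : siegel (siegel_mul (chart g) (chart h)).
  by apply: siegel_mulP; exact: chart_siegel.
have S' := chart_siegel (ltrans g h).
case E : (siegel_mul (chart g) (chart h)) S => [u v] S.
have uE : u = chart_u (ltrans g h) by rewrite e1; case: E.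
congr (_, _); first by rewrite uE.
move: S; rewrite /siegel /= => S.
have <- : complex.Re v = sqnorm (chart_u (ltrans g h)) / 2.
  by rewrite -uE -S; field.
suff <- : complex.Im v = g.2 + h.2 + symp g.1 h.1 by case: (v).
case: E => _ <-; rewrite raddfD /= raddf_sum /symp; congr (_ + _).
by apply: eq_bigr => j _; rewrite !mxE /=; ring.
Qed.

End GaugeSquare.

(** * Volumes of gauge balls *)

Section BallVolume.
Context (R : realType) (n : nat).
Local Notation plane := (measurableTypeR R * measurableTypeR R)%type.
Local Notation coords := (n.-tuple plane * measurableTypeR R)%type.
Implicit Types x y z h : coords.

(** Here [t] bounds the squared distance, so the gauge radius is the square root of [t] and the
    volume scales like t^(n+1). *)
Definition gball x (t : R) : set coords := [set h | gauge2 x h < t].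

Lemma measurable_coord1 (j : 'I_n) :
  measurable_fun [set: n.-tuple plane] (fun s => (tnth s j).1 : R).
Proof.
exact: (measurableT_comp (@measurable_fst _ _ _ _) (measurable_tnth j)).
Qed.

Lemma measurable_coord2 (j : 'I_n) :
  measurable_fun [set: n.-tuple plane] (fun s => (tnth s j).2 : R).
Proof.
exact: (measurableT_comp (@measurable_snd _ _ _ _) (measurable_tnth j)).
Qed.

Lemma measurable_symp s :
  measurable_fun [set: n.-tuple plane] (fun t => symp s t).
Proof.
apply: measurable_sum => j; apply: measurable_funB; apply: measurable_funM => //.
  exact: measurable_coord2.
exact: measurable_coord1.
Qed.

Lemma measurable_vert x : measurable_fun [set: coords] (vert x).
Proof.
apply: measurable_funB.
  by apply: measurable_funB => //; exact: measurable_snd.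
exact: (measurableT_comp (measurable_symp x.1) (@measurable_fst _ _ _ _)).
Qed.

Lemma measurable_horiz x : measurable_fun [set: coords] (horiz x).
Proof.
apply: measurable_sum => j; apply: measurable_funD; apply: measurable_funX;
  apply: measurable_funB => //.
- exact: (measurableT_comp (measurable_coord1 j) (@measurable_fst _ _ _ _)).
- exact: (measurableT_comp (measurable_coord2 j) (@measurable_fst _ _ _ _)).
Qed.

Lemma measurable_gauge2 x : measurable_fun [set: coords] (gauge2 x).
Proof.
rewrite (_ : gauge2 x = Num.sqrt \o
    (fun h => (horiz x h / 2) ^+ 2 + vert x h ^+ 2)); last first.
  by apply/funext => h; rewrite gauge2E.
apply: measurableT_comp.
  by apply: continuous_measurable_fun; exact: sqrt_continuous.
apply: measurable_funD; apply: measurable_funX; last exact: measurable_vert.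
by apply: measurable_funM => //; exact: measurable_horiz.
Qed.

Lemma measurable_gball x t : measurable (gball x t).
Proof.
rewrite (_ : gball x t = setT `&` gauge2 x @^-1` `]-oo, t[%classic).
  exact: (measurable_gauge2 x measurableT (measurable_itv _)).
by rewrite setTI; apply/seteqP; split=> h; rewrite /gball /= in_itv.
Qed.

Let cube (c : n.-tuple plane) (r : R) : set (n.-tuple plane) :=
  [set s | forall j, (ball (tnth c j).1 r `*` ball (tnth c j).2 r) (tnth s j)].

(** A cube in the horizontal coordinates with vertical fibres sheared by the group law; gauge balls
    are compared with these boxes from inside and outside. *)
Definition twisted_box x (r t : R) : set coords :=
  [set h | cube x.1 r h.1 /\ `|vert x h| < t].

Let measurable_cube c r : measurable (cube c r).
Proof.
rewrite (_ : cube c r = \bigcap_(j in [set: 'I_n]) ((@tnth _ plane)^~ j @^-1`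
    (ball (tnth c j).1 r `*` ball (tnth c j).2 r))).
  apply: fin_bigcap_measurable => // j _; rewrite -[X in measurable X]setTI.
  apply: measurable_tnth => //.
  by apply: measurableX; exact: measurable_ball.
by apply/seteqP; split => [s h j _|s h j]; [exact: h|exact: (h j)].
Qed.

Lemma power_measure_cube c r : 0 <= r ->
  power_measure (lebesgueC R) n (cube c r) = ((4 * r ^+ 2) ^+ n)%:E.
Proof.
move=> r0; rewrite (power_measure_box (lebesgueC R)
  (A := fun j => ball (tnth c j).1 r `*` ball (tnth c j).2 r)); last first.
  by move=> i; apply: measurableX; exact: measurable_ball.
rewrite (eq_bigr (fun=> (4 * r ^+ 2)%:E)); last first.
  move=> j _; transitivity
      (lebesgue_measure (ball (tnth c j).1 r) * lebesgue_measure (ball (tnth c j).2 r))%E.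
    by apply: product_measure1E; exact: measurable_ball.
  by rewrite !lebesgue_measure_ball// -EFinM; congr EFin; ring.
by rewrite prodEFin big_const card_ord iter_mulr_1.
Qed.

Lemma measurable_twisted_box x r t : measurable (twisted_box x r t).
Proof.
rewrite (_ : twisted_box x r t =
    (fst @^-1` cube x.1 r) `&` (vert x @^-1` `]-t, t[%classic)).
  apply: measurableI; rewrite -[X in measurable X]setTI.
    exact: (@measurable_fst _ _ _ _ measurableT).
  exact: (measurable_vert x measurableT (measurable_itv _)).
by apply/seteqP; split => h [h1 h2]; split => //; move: h2; rewrite /= in_itv /= ltr_norml.
Qed.

(** The shear moves the centre of each vertical fibre but not its length 2t, so Fubini's theorem
    gives the volume of a straight box. *)
Lemma haar_twisted_box x r t : 0 <= r -> 0 <= t ->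
  haar R n (twisted_box x r t) = ((4 * r ^+ 2) ^+ n * (2 * t))%:E.
Proof.
move=> r0 t0; transitivity
    (\int[power_measure (lebesgueC R) n]_s ((\1_(cube x.1 r) s)%:E * (2 * t)%:E))%E.
  apply: eq_integral => s _ /=; rewrite indicE.
  have [cs|cs] := boolP (s \in cube x.1 r).
    rewrite mul1e (_ : xsection _ _ = ball (x.2 + symp x.1 s) t).
      by rewrite [LHS]lebesgue_measure_ball//; congr EFin; rewrite mulr_natl.
    have distE (y : R) : `|x.2 + symp x.1 s - y| = `|vert x (s, y)|.
      have E (a b c : R) : `|a + b - c| = `|c - a - b|.
        by rewrite distrC opprD addrA.
      exact: (E x.2 (symp x.1 s) y).
    rewrite xsectionE; apply/seteqP; split => y; rewrite /ball /= distE.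
      by case.
    by move=> h; split => //; exact/set_mem.
  rewrite mul0e (_ : xsection _ _ = set0) ?measure0//.
  rewrite xsectionE -subset0 => y /= [h _].
  by move: cs; rewrite mem_set.
rewrite ge0_integralZr//; last by rewrite lee_fin; lra.
  by rewrite integral_indic// setIT [RHS]EFinM -(power_measure_cube x.1 r0).
exact/measurable_EFinP/measurable_indic.
Qed.

Definition vol_lb : R := n%:R ^- 2 ^+ n.
Definition vol_ub : R := 2 * 8 ^+ n.

Lemma vol_lb_gt0 : (0 < n)%N -> 0 < vol_lb.
Proof. by move=> n0; rewrite exprn_gt0// invr_gt0 exprn_gt0// ltr0n. Qed.

Lemma vol_ub_gt0 : 0 < vol_ub.
Proof. by rewrite mulr_gt0// exprn_gt0. Qed.

(** The ball contains the twisted box of half-side sqrt(t)/(2n) and half-height t/2: on it [horiz]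
    is at most t/2, and (t/4)^2 + (t/2)^2 < t^2. *)
Lemma haar_gball_ge x t : (0 < n)%N -> 0 < t ->
  ((vol_lb * t ^+ n.+1)%:E <= haar R n (gball x t))%E.
Proof.
move=> n0 t0; have nR0 : 0 < n%:R :> R by rewrite ltr0n.
have n1 : 1 <= n%:R :> R by rewrite ler1n.
pose r := Num.sqrt t / (2 * n%:R).
have r0 : 0 <= r by rewrite divr_ge0 ?sqrtr_ge0// mulr_ge0// ltW.
have r2 : 4 * r ^+ 2 = n%:R ^- 2 * t.
  by rewrite /r expr_div_n sqr_sqrtr ?ltW//; field; exact: lt0r_neq0.
have -> : vol_lb * t ^+ n.+1 = (4 * r ^+ 2) ^+ n * (2 * (t / 2)).
  by rewrite r2 exprMn exprS /vol_lb; move: (n%:R ^- 2 ^+ n) => w; field.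
rewrite -(haar_twisted_box x)//; last lra.
apply: le_measure; rewrite ?inE; [exact: measurable_twisted_box|exact: measurable_gball|].
move=> h [hc hv]; rewrite /gball /= /gauge2 lt_cmod ?ltW// Re_diff Im_diff.
have hh : horiz x h <= t / 2.
  apply: (@le_trans _ _ (\sum_(j < n) (2 * r ^+ 2))).
    apply: ler_sum => j _; have [/= h1 h2] := hc j.
    have sq (a b : R) : ball a r b -> (b - a) ^+ 2 <= r ^+ 2.
      rewrite /ball /= distrC => ab.
      by rewrite -[leLHS]real_normK ?num_real// ler_sqr ?nnegrE// ltW.
    have := sq _ _ h1; have := sq _ _ h2; lra.
  rewrite sumr_const card_ord -[leLHS]mulr_natr.
  have -> : 2 * r ^+ 2 * n%:R = t / 2 * n%:R^-1.
    transitivity ((4 * r ^+ 2) * n%:R / 2); first by field.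
    by rewrite r2; field; exact: lt0r_neq0.
  by rewrite ler_piMr ?invf_le1//; lra.
have h0 := horiz_ge0 x h.
have : (horiz x h / 2) ^+ 2 <= (t / 4) ^+ 2.
  by rewrite ler_sqr ?nnegrE; lra.
have : vert x h ^+ 2 < (t / 2) ^+ 2.
  by rewrite -[ltLHS]real_normK ?num_real// ltr_sqr ?nnegrE//; lra.
have := sqr_ge0 t; nra.
Qed.

(** The ball lies in the twisted box of half-side sqrt(2t) and half-height t, since [horiz] is at
    most twice [gauge2] and the vertical part at most [gauge2]. *)
Lemma haar_gball_le x t : 0 <= t ->
  (haar R n (gball x t) <= (vol_ub * t ^+ n.+1)%:E)%E.
Proof.
move=> t0; have r2 : 4 * Num.sqrt (2 * t) ^+ 2 = 8 * t.
  by rewrite sqr_sqrtr; [ring|lra].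
have -> : vol_ub * t ^+ n.+1 = (4 * Num.sqrt (2 * t) ^+ 2) ^+ n * (2 * t).
  by rewrite r2 exprMn exprS /vol_ub; ring.
rewrite -(haar_twisted_box x)//.
apply: le_measure; rewrite ?inE; [exact: measurable_gball|exact: measurable_twisted_box|].
move=> h; rewrite /gball /= => ht; split; last first.
  exact: le_lt_trans (vert_gauge2 _ _) ht.
have key (a b c : R) : (b - a) ^+ 2 + c ^+ 2 <= horiz x h -> ball a (Num.sqrt (2 * t)) b.
  move=> abc; rewrite /ball /= distrC.
  rewrite -ltr_sqr ?nnegrE ?sqrtr_ge0// real_normK ?num_real// sqr_sqrtr; last lra.
  have := horiz_gauge2 x h; have := sqr_ge0 c; lra.
move=> j; have hj : ((tnth h.1 j).1 - (tnth x.1 j).1) ^+ 2 +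
    ((tnth h.1 j).2 - (tnth x.1 j).2) ^+ 2 <= horiz x h.
  rewrite /horiz (bigD1 j)//= lerDl; apply: sumr_ge0 => i _.
  by rewrite addr_ge0// sqr_ge0.
by split; [exact: key hj|rewrite addrC in hj; exact: key hj].
Qed.

End BallVolume.

(** * The ring of Gaussian integers and its discreteness *)

Section GaussianIntegers.
Context (R : realType).
Implicit Types z w : R[i].

Lemma gaussian_intD z w : gaussian_int z -> gaussian_int w -> gaussian_int (z + w).
Proof.
move=> [a [b ->]] [c [d ->]]; exists (a + c), (b + d).
by rewrite !rmorphD.
Qed.

Lemma gaussian_intN z : gaussian_int z -> gaussian_int (- z).
Proof. by move=> [a [b ->]]; exists (- a), (- b); rewrite !rmorphN. Qed.

Lemma gaussian_intM z w : gaussian_int z -> gaussian_int w -> gaussian_int (z * w).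
Proof.
move=> [a [b ->]] [c [d ->]]; exists (a * c - b * d), (a * d + b * c).
by rewrite rmorphB rmorphD !rmorphM.
Qed.

Lemma gaussian_int_conj z : gaussian_int z -> gaussian_int (conjc z).
Proof. by move=> [a [b ->]]; exists a, (- b); rewrite rmorphN. Qed.

Lemma gaussian_int0 : gaussian_int (0 : R[i]).
Proof. by exists 0, 0. Qed.

Lemma gaussian_int_sum (I : finType) (F : I -> R[i]) :
  (forall i, gaussian_int (F i)) -> gaussian_int (\sum_i F i).
Proof.
by move=> h; elim/big_ind: _ => //; [exact: gaussian_int0|exact: gaussian_intD].
Qed.

Lemma cmod_gaussian_ge1 z : gaussian_int z -> z != 0 -> 1 <= cmod z.
Proof.
move=> [a [b ->]] ab0; rewrite leNgt lt_cmod// expr1n -leNgt /=.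
rewrite -!rmorphXn -rmorphD /= -[1]/(1%:~R) ler_int.
have : (a != 0) || (b != 0).
  by apply: contra_neqT ab0; rewrite negb_or !negbK => /andP[/eqP -> /eqP ->].
by case/orP => h; nia.
Qed.

End GaussianIntegers.

(** * Separation and packing of rational points *)

Section Denominators.
Context (R : realType) (n : nat).
Local Notation plane := (measurableTypeR R * measurableTypeR R)%type.
Local Notation coords := (n.-tuple plane * measurableTypeR R)%type.
Implicit Types x y z h : coords.

(** Any common denominator is accepted, reduced or not, so one point has many of them. *)
Definition denom x (q : R[i]) : Prop :=
  [/\ gaussian_int q, q != 0, forall j, gaussian_int (q * chart_u x 0 j) &
      gaussian_int (q * (chart x).2)].

Definition bounded_denom (Q : R) x : Prop := exists2 q, denom x q & cmod q <= Q.

Lemma siegel_diff_clear q q' (u u' : 'rV[R[i]]_n) v v' :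
  (siegel_mul (siegel_inv (u, v)) (u', v')).2 * (conjc q * q') =
  conjc (q * v) * q' + conjc q * (q' * v') -
  \sum_j conjc (q * u 0 j) * (q' * u' 0 j).
Proof.
rewrite /siegel_mul /siegel_inv /= hdotNl /hdot mulrDl mulNr mulr_suml.
congr (_ - _); first by rewrite rmorphM; ring.
by apply: eq_bigr => j _; rewrite rmorphM; ring.
Qed.

(* Clearing denominators turns the last coordinate of x^-1 * y into a non-zero
   Gaussian integer. *)
Lemma denom_separation x y q q' : denom x q -> denom y q' -> x <> y ->
  1 <= gauge2 x y * (cmod q * cmod q').
Proof.
move=> [Zq q0 Zu Zv] [Zq' q'0 Zu' Zv'] xy.
rewrite -(cmod_conj q) -!cmodM; apply: cmod_gaussian_ge1; last first.
  rewrite !mulf_neq0// ?conjc_eq0//; apply: contra_notN xy.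
  by rewrite -cmod_eq0 => /eqP; exact: gauge2_eq0.
have -> : (siegel_mul (siegel_inv (chart_u x, (chart x).2)) (chart_u y, (chart y).2)).2 *
      (conjc q * q') =
    conjc (q * (chart x).2) * q' + conjc q * (q' * (chart y).2) -
    \sum_j conjc (q * chart_u x 0 j) * (q' * chart_u y 0 j).
  move: (chart_u x) (chart_u y) (chart x).2 (chart y).2; exact: siegel_diff_clear.
apply: gaussian_intD; first apply: gaussian_intD.
- by apply: gaussian_intM => //; exact: gaussian_int_conj.
- by apply: gaussian_intM => //; exact: gaussian_int_conj.
- apply: gaussian_intN; apply: gaussian_int_sum => j.
  by apply: gaussian_intM => //; exact: gaussian_int_conj.
Qed.

Lemma bounded_denom_separation (Q Q' : R) x y : 0 < Q -> 0 < Q' ->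
  bounded_denom Q x -> bounded_denom Q' y -> x <> y ->
  (Q * Q')^-1 <= gauge2 x y.
Proof.
move=> Q0 Q'0 [q dq qQ] [q' dq' qQ'] xy.
rewrite -div1r ler_pdivrMr ?mulr_gt0//.
apply: le_trans (denom_separation dq dq' xy) _.
by rewrite ler_wpM2l ?gauge2_ge0// ler_pM ?cmod_ge0.
Qed.

(** A common point would put the centres at squared distance below 4t, against the separation
    1/Q^2. *)
Lemma gball_disjoint (Q t : R) x y h : 0 < Q -> t <= (4 * Q ^+ 2)^-1 ->
  bounded_denom Q x -> bounded_denom Q y -> gball x t h -> gball y t h -> x = y.
Proof.
move=> Q0 tQ Dx Dy xh yh; apply: contrapT => xy.
have := bounded_denom_separation Q0 Q0 Dx Dy xy.
have := gauge2_tri h x y; rewrite (gauge2_sym h y).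
have -> : (Q * Q)^-1 = 4 * (4 * Q ^+ 2)^-1 by field; exact: lt0r_neq0.
move: xh yh; rewrite /gball /=; lra.
Qed.

Definition gballs (X : {fset coords}) (t : R) : set coords :=
  \bigcup_(x in [set` X]) gball x t.

Lemma measurable_gballs X t : measurable (gballs X t).
Proof.
by apply: fin_bigcup_measurable => // x _; exact: measurable_gball.
Qed.

Lemma haar_gballs_ge (X : {fset coords}) (Q t : R) : (0 < n)%N -> 0 < Q ->
  0 < t -> t <= (4 * Q ^+ 2)^-1 -> (forall x, x \in X -> bounded_denom Q x) ->
  ((#|` X|%:R * (vol_lb R n * t ^+ n.+1))%:E <= haar R n (gballs X t))%E.
Proof.
move=> n0 Q0 t0 tQ XQ; rewrite /gballs bigcup_fset measure_fbigsetU//; first last.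
- move=> x y /= xX yX [h [xh yh]].
  by apply: gball_disjoint Q0 tQ _ _ xh yh; exact: XQ.
- by move=> x _; exact: measurable_gball.
apply: (@le_trans _ _ (\sum_(x <- X) (vol_lb R n * t ^+ n.+1)%:E)%E).
  by rewrite sumEFin big_const_seq count_predT iter_addr_0 mulr_natl.
by apply: lee_sum => x _; exact: haar_gball_ge.
Qed.

Lemma haar_gballs_le (X : {fset coords}) (t : R) : 0 <= t ->
  (haar R n (gballs X t) <= (#|` X|%:R * (vol_ub R n * t ^+ n.+1))%:E)%E.
Proof.
move=> t0; apply: (@le_trans _ _ (\sum_(x <- X) (vol_ub R n * t ^+ n.+1)%:E)%E).
  apply: (@le_trans _ _ (\sum_(x <- X) haar R n (gball x t))%E).
    rewrite fsbig_seq ?fset_uniq//; apply: content_sub_fsum => //.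
    - by move=> x _; exact: measurable_gball.
    - exact: measurable_gballs.
  by apply: lee_sum => x _; exact: haar_gball_le.
by rewrite sumEFin big_const_seq count_predT iter_addr_0 mulr_natl.
Qed.

Definition pack : R := vol_ub R n / vol_lb R n * 8 ^+ n.+1.

(** The disjoint balls of squared radius s = 1/(4Q^2) about the points all lie in the ball of
    squared radius 2(t + s) about [z]; comparing volumes bounds their number. *)
Lemma packing (X : {fset coords}) (Q t : R) z : (0 < n)%N -> 0 < Q -> 0 <= t ->
  (forall x, x \in X -> bounded_denom Q x /\ gauge2 z x <= t) ->
  #|` X|%:R <= pack * (Q ^+ 2 * t + 1) ^+ n.+1.
Proof.
move=> n0 Q0 t0 hX; pose s := (4 * Q ^+ 2)^-1.
have s0 : 0 < s by rewrite invr_gt0 mulr_gt0// exprn_gt0.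
have sub : gballs X s `<=` gball z (2 * (t + s)).
  move=> h [x /= /hX[_ zx] xh]; rewrite /gball /=.
  by apply: le_lt_trans (gauge2_tri x z h) _; rewrite ltr_pM2l// ler_ltD.
have ts0 : 0 <= 2 * (t + s) by rewrite mulr_ge0// addr_ge0// ltW.
have := haar_gballs_ge n0 Q0 s0 (lexx _) (fun x xX => (hX x xX).1).
move=> /le_trans/(_ (le_measure _ (mem_set (measurable_gballs _ _))
  (mem_set (measurable_gball _ _)) sub)).
move=> /le_trans/(_ (haar_gball_le z ts0)); rewrite lee_fin => h.
have v0 := vol_lb_gt0 R n0.
have sn0 : 0 < vol_lb R n * s ^+ n.+1 by rewrite mulr_gt0// exprn_gt0.
rewrite -(ler_pM2r sn0); apply: le_trans h _.
rewrite /pack.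
have -> : vol_ub R n / vol_lb R n * 8 ^+ n.+1 * (Q ^+ 2 * t + 1) ^+ n.+1 *
    (vol_lb R n * s ^+ n.+1) = vol_ub R n * (8 * (Q ^+ 2 * t + 1) * s) ^+ n.+1.
  rewrite !exprMn; move: (_ ^+ n.+1) (_ ^+ n.+1) (_ ^+ n.+1) => a b c.
  by field; exact: lt0r_neq0.
rewrite ler_pM2l ?vol_ub_gt0// lerXn2r ?nnegrE//.
  have : 0 <= Q ^+ 2 * t by rewrite mulr_ge0// sqr_ge0.
  by move=> ?; apply: mulr_ge0; [lra|exact: ltW].
have -> : 8 * (Q ^+ 2 * t + 1) * s = 2 * t + 8 * s.
  by rewrite /s; field; exact: lt0r_neq0.
lra.
Qed.

End Denominators.

(** * Rational points in bounded regions and the case of exponents above 1 *)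

Section RationalPoints.
Context (R : realType) (n : nat).
Local Notation plane := (measurableTypeR R * measurableTypeR R)%type.
Local Notation coords := (n.-tuple plane * measurableTypeR R)%type.
Implicit Types x y z h : coords.

Lemma gaussian_rat_div (z w : R[i]) :
  gaussian_int z -> gaussian_int w -> gaussian_rat (z / w).
Proof.
move=> [a [b ->]] [c [d ->]].
exists ((a * c + b * d)%:~R / (c * c + d * d)%:~R),
  ((b * c - a * d)%:~R / (c * c + d * d)%:~R).
rewrite !fmorph_div !rmorph_int.
rewrite rmorphB !rmorphD !rmorphM /=.
move: (a%:~R) (b%:~R) (c%:~R) (d%:~R) => {}a {}b {}c {}d.
have [cd0|cd0] := eqVneq (c * c + d * d) 0.
  move/eqP: cd0; rewrite -!expr2 paddr_eq0 ?sqr_ge0// !sqrf_eq0 => /andP[/eqP-> /eqP->].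
  have -> : 0 +i* 0 = 0 :> R[i] by [].
  by rewrite expr0n addr0 !invr0 !mulr0.
have w0 : c +i* d != 0.
  by apply: contra_neq cd0 => -[-> ->]; rewrite !mulr0 addr0.
apply/(mulIf w0); rewrite divfK//.
by apply/eqP; rewrite eq_complex /=; apply/andP; split; apply/eqP; field.
Qed.

Lemma denom_siegelQ x q : denom x q -> siegelQ (chart x).
Proof.
move=> [Zq q0 Zu Zv].
have rat (w : R[i]) : gaussian_int (q * w) -> gaussian_rat w.
  by move=> Zw; rewrite -(mulKf q0 w) mulrC; exact: gaussian_rat_div.
split; [exact: chart_siegel|move=> j|]; exact: rat.
Qed.

Definition approx (alpha : R) h : set coords :=
  [set x | exists2 q, denom x q & Num.sqrt (gauge2 h x) < cmod q `^ (- alpha)].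

(** A denominator determines the numerators as p = q u and r = q v, so it suffices to quantify over
    [q]. *)
Lemma approximants_chart alpha h :
  approximants alpha (chart h) = @chart R n @` approx alpha h.
Proof.
apply/seteqP; split => [x [[Sx _ _] [p [r [q [Zp Zr [Zq q0] xE hx]]]]]|].
  have [y yx] := chart_surj Sx; exists y => //; exists q.
    have uy : chart_u y = x.1 by rewrite -yx.
    split=> //; first by move=> j; rewrite uy xE /= mxE mulVKf.
    by rewrite yx xE /= mulrC divfK.
  by rewrite -gauge_dist_chart yx.
move=> _ [x [q dq hx] <-]; split; first exact: denom_siegelQ dq.
have [Zq q0 Zu Zv] := dq.
exists (q *: chart_u x), (q * (chart x).2), q; split=> //.
- by move=> j; rewrite mxE.
- by rewrite scalerA mulVf// scale1r mulrC mulKf.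
Qed.

Definition ratpts z (Q t : R) : set coords :=
  [set x | bounded_denom Q x /\ gauge2 z x <= t].

Hypothesis n_gt0 : (0 < n)%N.

Lemma finite_ratpts z Q t : 0 < Q -> 0 <= t -> finite_set (ratpts z Q t).
Proof.
move=> Q0 t0; apply: contrapT => inf.
pose N := (Num.truncn (pack R n * (Q ^+ 2 * t + 1) ^+ n.+1)).+1.
have [X XA NX] := infinite_set_fset N inf.
have := packing n_gt0 Q0 t0 XA; apply/negP; rewrite -ltNge.
apply: (@lt_le_trans _ _ N%:R); last by rewrite ler_nat.
by rewrite /N truncnS_gt.
Qed.

(** [fset_set] has the intended elements only for a finite set, which [finite_ratpts] ensures when
    [Q] is positive and [t] nonnegative. *)
Definition fratpts z Q t : {fset coords} := fset_set (ratpts z Q t).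

Lemma in_fratpts z Q t x : 0 < Q -> 0 <= t ->
  x \in fratpts z Q t <-> bounded_denom Q x /\ gauge2 z x <= t.
Proof.
move=> Q0 t0; rewrite /fratpts in_fset_set; last exact: finite_ratpts.
by split=> [/set_mem|/mem_set].
Qed.

Lemma card_fratpts z Q t : 0 < Q -> 0 <= t ->
  #|` fratpts z Q t|%:R <= pack R n * (Q ^+ 2 * t + 1) ^+ n.+1.
Proof. by move=> Q0 t0; apply: (packing n_gt0 Q0 t0) => x /in_fratpts; exact. Qed.

Lemma dyadic_scale (c : R) : 1 <= c -> exists j, 2 ^+ j <= c < 2 ^+ j.+1.
Proof.
move=> c1; pose N := Num.truncn c.
have /andP[Nc cN] : N%:R <= c < N.+1%:R.
  by apply: truncn_itv; lra.
have N0 : (0 < N)%N by rewrite lt0n; apply: contraTneq cN => ->; rewrite -leNgt.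
exists (trunc_log 2 N); apply/andP; split.
  by apply: le_trans Nc; rewrite -natrX ler_nat trunc_logP.
by apply: lt_le_trans cN _; rewrite -natrX ler_nat trunc_log_ltn.
Qed.

Lemma pack_gt0 : 0 < pack R n.
Proof.
by rewrite /pack mulr_gt0 ?exprn_gt0// divr_gt0 ?vol_ub_gt0 ?vol_lb_gt0.
Qed.

(** For |q| near 2^j there are O(4^(j(n+1))) points in a bounded region, and balls of squared radius
    b^j with b = 2^(-2 alpha). The measures are dominated by a geometric series of ratio (4b)^(n+1),
    and 4b < 1 because alpha > 1. *)
Lemma approx_finite_ae (alpha : R) : 1 < alpha ->
  (haar R n).-negligible [set h | infinite_set (approx alpha h)].
Proof.
move=> alpha1; pose o : coords := ([tuple (0, 0) | _ < n], 0).
pose b : R := (2 `^ (- alpha)) ^+ 2.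
have p0 : 0 < 2 `^ (- alpha) :> R by exact: powR_gt0.
have b0 : 0 < b by rewrite exprn_gt0.
have b4 : 4 * b < 1.
  have : 2 `^ (- alpha) < 2 `^ (- 1) :> R.
    by rewrite /powR gt_eqF// ltr_expR ltr_pM2r ?ltrN2// ln_gt0// ltr1n.
  rewrite powR_inv1// => h.
  have : (2 `^ (- alpha)) ^+ 2 < (2^-1) ^+ 2 :> R by rewrite ltr_sqr ?nnegrE// ltW.
  by rewrite -/b; lra.
have powj j : ((2 ^+ j : R) `^ (- alpha)) ^+ 2 = b ^+ j.
  rewrite -[2 ^+ j]powR_mulrn// powRAC powR_mulrn ?powR_ge0//.
  by rewrite /b exprAC.
(* The index [m] exhausts the group by bounded regions, and [j] is the dyadic range of the
   denominator. *)
pose V (m j : nat) := gballs (fratpts o (2 ^+ j.+1) (2 * m.+1%:R)) (b ^+ j).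
have mV m j : measurable (V m j) by exact: measurable_gballs.
have cover : [set h | infinite_set (approx alpha h)] `<=`
    \bigcup_m lim_sup_set (V m).
  move=> h hinf; pose m := (Num.truncn (gauge2 o h)).+1.
  have hm : gauge2 o h <= m%:R by rewrite ltW// truncnS_gt.
  exists m => // N _.
  have tm : 0 <= 2 * m.+1%:R :> R by rewrite mulr_ge0.
  (* Only finitely many points of the region have a denominator of modulus at most 2^N, so
     infinitely many approximants must include one outside that list. *)
  have [x [hx Nx]] : exists x, approx alpha h x /\ ~ ratpts o (2 ^+ N) (2 * m.+1%:R) x.
    apply: contrapT => /forallNP H; apply: hinf.
    apply: sub_finite_set (finite_ratpts o (exprn_gt0 N (ltr0Sn _ 1)) tm).
    by move=> x hx; apply: contrapT => nx; apply: (H x).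
  have [q dq hq] := hx; have [Zq q0 _ _] := dq.
  have q1 := cmod_gaussian_ge1 Zq q0.
  have [j /andP[jq qj]] := dyadic_scale q1.
  have hxj : gauge2 h x < b ^+ j.
    rewrite -powj -[ltLHS]sqr_sqrtr ?gauge2_ge0//.
    rewrite ltr_sqr ?nnegrE ?sqrtr_ge0 ?powR_ge0//; apply: lt_le_trans hq _.
    rewrite !powRN lef_pV2 ?posrE ?powR_gt0 ?exprn_gt0//; last by rewrite (lt_le_trans _ q1).
    by apply: ge0_ler_powR; rewrite ?nnegrE ?cmod_ge0 ?exprn_ge0//; lra.
  have bj1 : b ^+ j <= 1 by rewrite exprn_ile1//; lra.
  (* The point [h] is within m of the origin and [x] is within 1 of [h], in squared distance. *)
  have ox : gauge2 o x <= 2 * m.+1%:R.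
    apply: le_trans (gauge2_tri h o x) _; rewrite -natr1; lra.
  have Nj : (N <= j)%N.
    rewrite leqNgt; apply/negP => jN; apply: Nx; split => //; exists q => //.
    by apply: le_trans (ltW qj) _; apply: ler_weXn2l => //; rewrite ler1n.
  exists j => //; exists x => /=; last by rewrite /gball /= gauge2_sym.
  apply/(in_fratpts o x (exprn_gt0 _ (ltr0Sn _ 1)) tm).
  by split => //; exists q => //; exact: ltW.
apply: negligibleS cover _; apply: negligible_bigcup => m.
apply/negligibleP.
  by apply: bigcap_measurable => // N _; exact: bigcup_measurable.
apply: lim_sup_set_cvg0 => //.
pose K := pack R n * (8 * m.+1%:R + 1) ^+ n.+1 * vol_ub R n.
pose r := (4 * b) ^+ n.+1.
have m0 : 0 < m.+1%:R :> R by rewrite ltr0n.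
have K0 : 0 < K.
  apply: mulr_gt0; last exact: vol_ub_gt0.
  by apply: mulr_gt0; [exact: pack_gt0|apply: exprn_gt0; lra].
have r1 : r < 1 by rewrite exprn_ilt1//; lra.
have r0 : 0 < r by rewrite exprn_gt0// mulr_gt0.
apply: (@le_lt_trans _ _ (K * (1 - r)^-1)%:E); last exact: ltry.
apply: lime_le; first exact: is_cvg_nneseries.
apply: nearW => N.
apply: (@le_trans _ _ (\sum_(0 <= j < N) (geometric K r j)%:E)%E); last first.
  rewrite sumEFin lee_fin; apply: geometric_le_lim; [exact: ltW|exact: r0|].
  by rewrite ger0_norm// ltW.
apply: lee_sum => j _.
apply: (le_trans (haar_gballs_le _ (exprn_ge0 j (ltW b0)))).
rewrite lee_fin /=.
have Q0 : 0 < 2 ^+ j.+1 :> R by rewrite exprn_gt0.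
have t0 : 0 <= 2 * m.+1%:R :> R by rewrite mulr_ge0.
apply: (@le_trans _ _ (pack R n * ((2 ^+ j.+1) ^+ 2 * (2 * m.+1%:R) + 1) ^+ n.+1 *
  (vol_ub R n * b ^+ j ^+ n.+1))).
  by rewrite ler_wpM2r ?card_fratpts// mulr_ge0 ?exprn_ge0// ltW// vol_ub_gt0.
have -> : K * r ^+ j = pack R n * (4 ^+ j * (8 * m.+1%:R + 1)) ^+ n.+1 *
  (vol_ub R n * b ^+ j ^+ n.+1).
  rewrite /K /r [(4 * b) ^+ _]exprMn !exprMn -!exprM ![(j * _)%N]mulnC; ring.
rewrite ler_pM2r; last by rewrite mulr_gt0 ?vol_ub_gt0// !exprn_gt0.
have j1 : 1 <= 4 ^+ j :> R by rewrite exprn_ege1// ler1n.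
have E : (2 ^+ j.+1) ^+ 2 = 4 * 4 ^+ j :> R.
  by rewrite -exprM mulnC exprM -exprS; congr (_ ^+ _); ring.
rewrite ler_pM2l ?pack_gt0// E lerXn2r ?nnegrE//; nra.
Qed.

End RationalPoints.

(** * A positive proportion of integer pairs is coprime *)

Section CoprimePairs.
Local Open Scope set_scope.

Lemma card_sub_image (T U : finType) (f : T -> U) (A : {set U}) :
  (forall u, u \in A -> exists t, f t = u) -> (#|A| <= #|T|)%N.
Proof.
move=> h; rewrite -[leqRHS]cardsT; apply: leq_trans (leq_imset_card f [set: T]).
by apply/subset_leq_card/fintype.subsetP => u /h[t <-]; exact: imset_f.
Qed.

Lemma card_ord_lt N m : (#|[set a : 'I_N | (a < m)%N]| <= m)%N.
Proof.
case: (leqP m N) => mN; last first.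
  by apply: leq_trans (max_card _) _; rewrite card_ord ltnW.
rewrite -[leqRHS](card_ord m); apply: (card_sub_image (f := widen_ord mN)) => a.
by rewrite inE => am; exists (Ordinal am); exact: val_inj.
Qed.

Lemma card_ord_dvd M d : (0 < d)%N ->
  (#|[set a : 'I_M.+1 | (0 < a)%N && (d %| a)%N]| <= M %/ d)%N.
Proof.
move=> d0; rewrite -[leqRHS](card_ord (M %/ d)).
apply: (card_sub_image (f := fun m : 'I_(M %/ d) => inord (m.+1 * d))) => a.
rewrite inE => /andP[a0 /dvdnP[c ac]].
have c0 : (0 < c)%N by case: c ac a0 => // ->.
have cM : (c.-1 < M %/ d)%N.
  by rewrite prednK// leq_divRL// -ac -ltnS.
by exists (Ordinal cM); apply: val_inj; rewrite /= prednK// -ac inordK.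
Qed.

(* The constant 3/4 is 1/4 plus the telescoping tail sum of 1/(d(d-1)). *)
Lemma sum_sqr_divn M N :
  (4 * (\sum_(2 <= d < N) (M %/ d) ^ 2) <= 3 * M ^ 2)%N.
Proof.
(* The induction carries the bound 4M^2/N for the remaining tail. *)
suff : forall N, (2 <= N)%N -> ((4 * (\sum_(2 <= d < N.+1) (M %/ d) ^ 2))%:R +
    4 * M%:R ^+ 2 / N%:R <= 3 * M%:R ^+ 2 :> rat).
  move=> h; case: (leqP N 3) => N3.
    rewrite (leq_trans _ (_ : 4 * (\sum_(2 <= d < 3) (M %/ d) ^ 2) <= _)%N)//.
      rewrite leq_mul2l /=; case: N N3 => [|[|[|[|//]]]] _ //.
      - by rewrite big_geq.
      - by rewrite big_geq.
      - by rewrite big_geq.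
    rewrite -(@ler_nat rat) [leRHS]natrM natrX.
    apply: le_trans (h 2%N isT); rewrite lerDl divr_ge0// mulr_ge0// sqr_ge0.
  case: N N3 => // N N3; rewrite -(@ler_nat rat) [leRHS]natrM natrX.
  by apply: le_trans (h N (ltnW N3)); rewrite lerDl divr_ge0// mulr_ge0// sqr_ge0.
move=> {}N; elim: N => // N IH; rewrite leq_eqVlt => /orP[/eqP <-|].
  rewrite big_nat1 natrM natrX.
  have : (2 * (M %/ 2))%:R <= M%:R :> rat.
    by rewrite ler_nat mulnC leq_trunc_div.
  rewrite natrM => hM; have : 0 <= (M %/ 2)%:R :> rat by rewrite ler0n.
  by move: ((M %/ 2)%:R) (M%:R) hM => x y; nra.
rewrite ltnS => N2; have {}IH := IH N2.
rewrite big_nat_recr/=; last by rewrite ltnW.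
have e4 : (4 * (M %/ N.+1) ^ 2)%:R = 4 * (M %/ N.+1)%:R ^+ 2 :> rat.
  by rewrite natrM natrX.
rewrite mulnDr natrD {}e4.
have N0 : 2 <= N%:R :> rat by rewrite (ler_nat _ 2).
have : (N.+1 * (M %/ N.+1))%:R <= M%:R :> rat.
  by rewrite ler_nat mulnC leq_trunc_div.
rewrite natrM -[N.+1%:R]natr1 => hM.
suff : 4 * (M %/ N.+1)%:R ^+ 2 + 4 * M%:R ^+ 2 / (N%:R + 1) <= 4 * M%:R ^+ 2 / N%:R :> rat.
  by move: IH; lra.
have q0 : 0 <= (M %/ N.+1)%:R :> rat by rewrite ler0n.
move: ((M %/ N.+1)%:R) (M%:R) (N%:R) q0 hM N0 => q m N' q0 hM N0.
rewrite ler_pdivlMr; last lra.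
rewrite -subr_ge0 (_ : _ - _ = 4 * (m ^+ 2 - q ^+ 2 * N' * (N' + 1)) / (N' + 1)).
  2: by field; lra.
rewrite divr_ge0//; last lra.
have : (N' + 1) ^+ 2 * q ^+ 2 <= m ^+ 2.
  by rewrite -exprMn ler_sqr ?nnegrE; nra.
have := sqr_ge0 q; nra.
Qed.

(** The lower bound on the first entry [a] keeps |a + ib| comparable to M, so that quotients with
    numerators of that size stay bounded. *)
Definition coprime_pairs M : {set 'I_M.+1 * 'I_M.+1} :=
  [set ab : 'I_M.+1 * 'I_M.+1 | coprime ab.1 ab.2 && (M.+1 <= 8 * ab.1)%N].

(** Discarding small [a] costs about 1/8 of the pairs, the column b = 0 a linear term, and common
    divisors d >= 2 at most 3/4. The bound on [M] absorbs the linear terms and leaves 1/16. *)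
Lemma card_coprime_pairs M : (48 <= M)%N -> (M.+1 ^ 2 <= 16 * #|coprime_pairs M|)%N.
Proof.
move=> M48.
pose D d := [set a : 'I_M.+1 | (0 < a)%N && (d %| a)%N].
pose L := [set a : 'I_M.+1 | (a < M.+1 %/ 8 + 1)%N].
have cover : [set: 'I_M.+1 * 'I_M.+1] \subset coprime_pairs M :|:
    (finset.setX L [set: 'I_M.+1] :|: (finset.setX [set: 'I_M.+1] [set ord0] :|:
     \bigcup_(d < M.+1 | (2 <= d)%N) finset.setX (D d) (D d))).
  apply/fintype.subsetP => -[a b] _; rewrite !inE /= andbT.
  case: (ltnP a (M.+1 %/ 8 + 1)) => //= aL; first by rewrite orbT.
  case: (eqVneq b ord0) => [//|b0]; first by rewrite !orbT.
  have a8 : (M.+1 <= 8 * a)%N.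
    by rewrite addn1 ltn_divLR// in aL; rewrite mulnC ltnW.
  rewrite a8 andbT; case: (boolP (coprime a b)) => //= cab.
  have a0 : (0 < a)%N by rewrite (leq_trans _ aL)// addn1.
  have {}b0 : (0 < b)%N by rewrite lt0n; apply: contra_neq b0 => b0; exact: val_inj.
  have gM : (gcdn a b < M.+1)%N.
    by apply: leq_ltn_trans (ltn_ord a); apply: dvdn_leq => //; exact: dvdn_gcdl.
  apply/bigcupP; exists (Ordinal gM) => /=.
    by rewrite ltn_neqAle eq_sym cab gcdn_gt0 a0.
  by rewrite !inE /= a0 b0 dvdn_gcdl dvdn_gcdr.
have := subset_leq_card cover; rewrite cardsT card_prod card_ord.
move=> /leq_trans/(_ (leq_card_setU _ _)).
move=> /leq_trans/(_ (leq_add (leqnn _) (leq_card_setU _ _))).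
move=> /leq_trans/(_ (leq_add (leqnn _) (leq_add (leqnn _) (leq_card_setU _ _)))).
rewrite !cardsX !cardsT card_ord cards1 muln1.
have cL : (#|L| <= M.+1 %/ 8 + 1)%N by exact: card_ord_lt.
have cD : (4 * #|\bigcup_(d < M.+1 | (2 <= d)%N) finset.setX (D d) (D d)| <= 3 * M ^ 2)%N.
  apply: leq_trans (sum_sqr_divn M M.+1); rewrite leq_mul2l /=.
  apply: (@leq_trans (\sum_(d < M.+1 | (2 <= d)%N) #|finset.setX (D d) (D d)|)).
    elim/big_rec2: _ => [|d m A _ IH]; first by rewrite cards0.
    by apply: leq_trans (leq_card_setU _ _) _; rewrite leq_add2l.
  rewrite -(big_geq_mkord 2 M.+1 xpredT (fun d => #|finset.setX (D d) (D d)|)).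
  rewrite big_nat [leqRHS]big_nat; apply: leq_sum => d /andP[d2 _].
  by rewrite cardsX mulnn leq_sqr card_ord_dvd// ltnW.
move=> h; have := leq_trunc_div M.+1 8.
set A := #|coprime_pairs M| in h *; set l := #|L| in h cL.
set e := #|_| in h cD; set f := (M.+1 %/ 8)%N in cL *.
nia.
Qed.

End CoprimePairs.

(** * Construction of rational points with a prescribed denominator *)

Section CountingRationalPoints.
Context (R : realType) (n : nat).
Local Notation plane := (measurableTypeR R * measurableTypeR R)%type.
Local Notation coords := (n.-tuple plane * measurableTypeR R)%type.
Implicit Types x y h : coords.

Definition origin : coords := ([tuple (0, 0) | _ < n], 0).

Lemma gauge2_le x h : gauge2 x h <= horiz x h / 2 + `|vert x h|.
Proof.
have h0 := horiz_ge0 x h.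
have h2 : 0 <= horiz x h / 2 by lra.
rewrite /gauge2 le_cmod ?addr_ge0// Re_diff Im_diff.
rewrite -(real_normK (num_real (vert x h))); have := normr_ge0 (vert x h); nra.
Qed.

(** The horizontal part of the points constructed below contributes at most 256n, and the vertical
    part less than 1, hence at most n. *)
Definition radius : R := 257 * n%:R.

Lemma radius_ge0 : 0 <= radius. Proof. by rewrite mulr_ge0. Qed.

Lemma gaussian_int_nat (a b : nat) : gaussian_int (a%:R +i* b%:R : R[i]).
Proof. by exists a, b. Qed.

(* With [a e + b f = 1] and [s = |p|^2 / 2], the numerator [s (e + i f)]
   satisfies the Siegel equation; adding multiples of [i q] moves the vertical
   coordinate into the unit interval. *)
Lemma exists_ratpt (a b N : nat) (c d : 'I_n -> nat) :
  (0 < n)%N -> (0 < a)%N -> coprime a b -> (N <= 8 * a)%N ->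
  (forall j, (c j < N)%N /\ (d j < N)%N) ->
  let q : R[i] := a%:R +i* b%:R in
  exists x, [/\ denom x q, gauge2 origin x <= radius &
    forall j, q * chart_u x 0 j = (2 * c j)%:R +i* (2 * d j)%:R].
Proof.
move=> n0 a0 cab N8a cdN q.
have aR : 0 < a%:R :> R by rewrite ltr0n.
have q0 : q != 0 by rewrite eq_complex /= gt_eqF.
have ab0 : 0 < a%:R ^+ 2 + b%:R ^+ 2 :> R by rewrite ltr_pwDl ?exprn_gt0// sqr_ge0.
have [E [F [[e Ee] [f Ff] EF]]] : exists E F : R, [/\ exists e : int, E = e%:~R,
    exists f : int, F = f%:~R & a%:R * E + b%:R * F = 1].
  have /coprimezP[[e f] /= ef] : coprimez a%:Z b%:Z by [].
  exists e%:~R, f%:~R; split; [by exists e|by exists f|].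
  have := congr1 (fun z : int => z%:~R : R) ef.
  rewrite rmorphD !rmorphM /= => ef1; apply: etrans ef1.
  by rewrite [_ * e%:~R]mulrC [_ * f%:~R]mulrC.
pose u j : R[i] := ((2 * c j)%:R +i* (2 * d j)%:R) / q.
have qu j : q * u j = (2 * c j)%:R +i* (2 * d j)%:R by rewrite /u mulrC divfK.
have u2 j : (complex.Re (u j)) ^+ 2 + (complex.Im (u j)) ^+ 2 =
    4 * ((c j)%:R ^+ 2 + (d j)%:R ^+ 2) / (a%:R ^+ 2 + b%:R ^+ 2).
  rewrite -cmod_sqr /u cmodM ComplexField.Normc.normcV exprMn exprVn !cmod_sqr.
  by rewrite /= !natrM; congr (_ / _); ring.
(* The even numerators make half of |p|^2 an integer; [sn] is that integer as a natural number. *)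
pose s : R := \sum_j 2 * ((c j)%:R ^+ 2 + (d j)%:R ^+ 2).
pose sn : nat := (\sum_j 2 * (c j ^ 2 + d j ^ 2))%N.
have snE : sn%:R = s.
  by rewrite /sn natr_sum; apply: eq_bigr => j _; rewrite natrM natrD !natrX.
pose r0 : R[i] := (s * E) +i* (s * F).
pose t : int := - Num.floor (complex.Im (r0 / q)).
pose v : R[i] := r0 / q + 0 +i* t%:~R.
have rq : r0 / q = s / (a%:R ^+ 2 + b%:R ^+ 2) +i*
    (s * (F * a%:R - E * b%:R) / (a%:R ^+ 2 + b%:R ^+ 2)).
  apply: (mulIf q0); rewrite divfK// /r0 /q.
  move: EF ab0; move: (a%:R : R) (b%:R : R) (s) => A B S EF AB0.
  have AB : A ^+ 2 + B ^+ 2 != 0 by exact: lt0r_neq0.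
  apply/eqP; rewrite eq_complex /=; apply/andP; split; apply/eqP.
    transitivity (S * (E * (A ^+ 2 + B ^+ 2)) / (A ^+ 2 + B ^+ 2)); first by field.
    have -> : E * (A ^+ 2 + B ^+ 2) = A * (A * E + B * F) - B * (F * A - E * B) by ring.
    by rewrite EF; field.
  transitivity (S * (F * (A ^+ 2 + B ^+ 2)) / (A ^+ 2 + B ^+ 2)); first by field.
  have -> : F * (A ^+ 2 + B ^+ 2) = B * (A * E + B * F) + A * (F * A - E * B) by ring.
  by rewrite EF; field.
have Imv : 0 <= complex.Im v < 1.
  have -> : complex.Im v = complex.Im (r0 / q) + t%:~R by rewrite /v raddfD.
  rewrite /t; move: (complex.Im (r0 / q)) => y.
  have /andP[h1 h2] := floor_itv y; rewrite intrD in h2.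
  rewrite mulrNz subr_ge0 ltrBlDl h1 /=; exact: h2.
pose x : coords := ([tuple (complex.Re (u j), complex.Im (u j)) | j < n], complex.Im v).
have ux j : chart_u x 0 j = u j.
  by rewrite mxE tnth_mktuple; apply/eqP; rewrite eq_complex !eqxx.
have sx : sqnorm (chart_u x) / 2 = s / (a%:R ^+ 2 + b%:R ^+ 2).
  rewrite /sqnorm /s !mulr_suml; apply: eq_bigr => j _.
  by rewrite ux cmod_sqr u2; field; exact: lt0r_neq0.
have vx : (chart x).2 = v.
  have Rev : complex.Re v = s / (a%:R ^+ 2 + b%:R ^+ 2).
    by rewrite /v raddfD rq /= addr0.
  by apply/eqP; rewrite eq_complex Rev /= sx !eqxx.
exists x; split.
- split => //; first exact: gaussian_int_nat.
    by move=> j; rewrite ux qu; exact: gaussian_int_nat.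
  rewrite vx /v mulrDr [q * (r0 / q)]mulrC divfK//; apply: gaussian_intD.
    by exists (sn%:Z * e), (sn%:Z * f); rewrite !rmorphM /= /r0 Ee Ff -snE.
  apply: gaussian_intM; first exact: gaussian_int_nat.
  by exists 0, t.
- apply: le_trans (gauge2_le _ _) _.
  have -> : vert origin x = complex.Im v.
    rewrite /vert /symp big1 ?subr0// => j _; rewrite tnth_mktuple /=.
    by rewrite !mul0r subr0.
  have -> : horiz origin x = 2 * (s / (a%:R ^+ 2 + b%:R ^+ 2)).
    rewrite -sx sqnorm_chart_u; transitivity (\sum_j ((tnth x.1 j).1 ^+ 2 + (tnth x.1 j).2 ^+ 2)).
      by apply: eq_bigr => j _; rewrite !tnth_mktuple /= !subr0.
    by field.
  have sle : s <= \sum_(j < n) 2 * (2 * (64 * a%:R ^+ 2)).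
    apply: ler_sum => j _; have [cN dN] := cdN j.
    have cl : (c j)%:R <= 8 * a%:R :> R.
      by rewrite -natrM ler_nat (leq_trans (ltnW cN)).
    have dl : (d j)%:R <= 8 * a%:R :> R.
      by rewrite -natrM ler_nat (leq_trans (ltnW dN)).
    have c0 : 0 <= (c j)%:R :> R by [].
    have d0 : 0 <= (d j)%:R :> R by [].
    nra.
  rewrite sumr_const card_ord -[leRHS]mulr_natr in sle.
  have n1 : 1 <= n%:R :> R by rewrite ler1n.
  have : s / (a%:R ^+ 2 + b%:R ^+ 2) <= 256 * n%:R.
    rewrite ler_pdivrMr//; have := sqr_ge0 (b%:R : R); nra.
  rewrite /radius ger0_norm; last by case/andP: Imv.
  by case/andP: Imv => _; lra.
- by move=> j; rewrite ux.
Qed.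

End CountingRationalPoints.

(** * Counting through a map with bounded fibres *)

Section Multiplicity.
Local Open Scope set_scope.

Lemma card_le_fibers (T : finType) (C : choiceType) (f : T -> C) (S : {set T})
    (Y : {fset C}) (m : nat) :
  (forall y, y \in Y -> (#|[set t in S | f t == y]| <= m)%N) ->
  (#|[set t in S | f t \in Y]| <= #|` Y| * m)%N.
Proof.
move=> h.
apply: (@leq_trans (\sum_(y <- Y) #|[set t in S | f t == y]|)%N); last first.
  rewrite -sum1_size big_distrl /= big_seq [leqRHS]big_seq.
  by apply: leq_sum => y yY; rewrite mul1n h.
rewrite -sum1_card big_mkcond /=.
under [leqRHS]eq_bigr do rewrite -sum1_card big_mkcond /=.
rewrite exchange_big /=; apply: leq_sum => t _; rewrite inE.
case: ifPn => // /andP[tS tY].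
rewrite (big_rem (f t))//= inE tS eqxx /=.
exact: leq_addr.
Qed.

End Multiplicity.

(** * A lower bound for the number of rational points *)

Section Counting.
Context (R : realType) (n : nat).
Local Notation plane := (measurableTypeR R * measurableTypeR R)%type.
Local Notation coords := (n.-tuple plane * measurableTypeR R)%type.
Implicit Types x y h : coords.
Hypothesis n_gt0 : (0 < n)%N.

Let rad : R := radius R n.
Let o : coords := origin R n.

(** The factor 2 leaves room for |a + ib| when a and b are at most 2^k. *)
Definition low_points (k : nat) : {fset coords} := fratpts o (2 * 2 ^+ k) rad.

Lemma in_low_points k x :
  x \in low_points k <-> bounded_denom (2 * 2 ^+ k) x /\ gauge2 o x <= rad.
Proof.
by apply: in_fratpts; rewrite ?mulr_gt0 ?exprn_gt0//; exact: radius_ge0.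
Qed.

Definition low_const : R := pack R n * (4 * rad + 1) ^+ n.+1.

Lemma low_const_gt0 : 0 < low_const.
Proof.
rewrite mulr_gt0 ?pack_gt0// exprn_gt0//.
have r0 : 0 <= rad := radius_ge0 R n; lra.
Qed.

Lemma card_low_points k :
  #|` low_points k|%:R <= low_const * (4 ^+ k) ^+ n.+1.
Proof.
have r0 : 0 <= rad := radius_ge0 R n.
have Q0 : 0 < 2 * 2 ^+ k :> R by rewrite mulr_gt0 ?exprn_gt0.
apply: (le_trans (card_fratpts n_gt0 o Q0 r0)).
rewrite /low_const -mulrA -exprMn ler_pM2l ?pack_gt0//.
have -> : (2 * 2 ^+ k) ^+ 2 = 4 * 4 ^+ k :> R.
  by rewrite exprMn exprAC -!natrX.
have : 1 <= 4 ^+ k :> R by rewrite exprn_ege1// ler1n.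
by move=> k1; rewrite lerXn2r ?nnegrE//; nra.
Qed.

Section Scale.
Variables (k M : nat).
Hypothesis MK : M.+1 = (2 ^ k)%N.

(** A parameter consists of a candidate denominator a + ib and of halved numerators. Several
    parameters may yield the same point, so the fibres have to be controlled. *)
Let T : finType := (('I_M.+1 * 'I_M.+1) * {ffun 'I_n -> 'I_M.+1 * 'I_M.+1})%type.

Let S : {set T} := [set t : T | t.1 \in coprime_pairs M]%SET.

Let q (t : T) : R[i] := (t.1.1%:R +i* t.1.2%:R).

Let assigned (t : T) x : Prop := [/\ denom x (q t), gauge2 o x <= rad &
    forall j, q t * chart_u x 0 j =
      (2 * (t.2 j).1)%:R +i* (2 * (t.2 j).2)%:R].

Lemma exists_assigned (t : T) : exists x, t \in S -> assigned t x.
Proof.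
have [tS|tS] := boolP (t \in S); last by exists o.
move: (tS); rewrite !inE => /andP[cab M8].
have a0 : (0 < t.1.1)%N by rewrite lt0n; apply: contraTneq M8 => ->; rewrite muln0.
have [x [h1 h2 h3]] := @exists_ratpt R n t.1.1 t.1.2 M.+1
  (fun j => (t.2 j).1) (fun j => (t.2 j).2) n_gt0 a0 cab M8
  (fun j => conj (ltn_ord _) (ltn_ord _)).
by exists x => _; split.
Qed.

Variable f : T -> coords.
Hypothesis fP : forall t, t \in S -> assigned t (f t).

(** The numerators are recovered from the point and the denominator as q u. *)
Lemma assigned_inj (t t' : T) : t \in S -> t' \in S -> f t = f t' ->
  t.1 = t'.1 -> t = t'.
Proof.
move=> /fP[_ _ ht] /fP[_ _ ht'] ff tt.
case: t t' tt ht ht' ff => [ab p] [ab' p'] /= -> ht ht' ff.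
congr (_, _); apply/ffunP => j; have := ht' j; rewrite -ff -/(q (ab', p')).
have -> : q (ab', p') = q (ab', p) by [].
rewrite ht => -[/eqP + /eqP]; rewrite !eqr_nat !eqn_pmul2l//.
by case: (p j) (p' j) => c d [c' d'] /= /eqP/val_inj-> /eqP/val_inj->.
Qed.

(* Two denominators of the same point lying in the same square cell of side
   2^i differ by a denominator of modulus at most 2 * 2^i. *)
Lemma card_fiber i x : (i <= k)%N -> i = 0%N \/ ~ bounded_denom (2 * 2 ^+ i) x ->
  (#|[set t in S | f t == x]%SET| <= 4 ^ (k - i))%N.
Proof.
move=> ik hx; pose m := (2 ^ i)%N.
have m0 : (0 < m)%N by rewrite expn_gt0.
have div_lt (a : 'I_M.+1) : (a %/ m < 2 ^ (k - i))%N.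
  by rewrite ltn_divLR// /m -expnD subnK// -MK.
pose g (t : T) : 'I_(2 ^ (k - i)) * 'I_(2 ^ (k - i)) :=
  (Ordinal (div_lt t.1.1), Ordinal (div_lt t.1.2)).
have g_inj : {in [set t in S | f t == x]%SET &, injective g}.
  move=> t t' /finset.setIdP[tS /eqP tx] /finset.setIdP[tS' /eqP tx'].
  move=> -[e1 e2]; apply: assigned_inj => //; first by rewrite tx.
  (* For i = 0 the cells have side 1, so the cell already determines the pair. *)
  apply: contrapT => tt'; case: hx => [i0|].
    apply: tt'; move: e1 e2; rewrite /m i0 !divn1.
    by case: (t.1) (t'.1) => ? ? [? ?] /= /val_inj-> /val_inj->.
  apply; exists (q t - q t').
    have [[Zq q0 Zu Zv] _ _] := fP tS; have [[Zq' q0' Zu' Zv'] _ _] := fP tS'.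
    rewrite tx in Zu Zv; rewrite tx' in Zu' Zv'.
    split.
    - by apply: gaussian_intD => //; exact: gaussian_intN.
    - rewrite subr_eq0; apply: contra_notN tt' => /eqP; rewrite /q.
      case: (t.1) (t'.1) => [a b] [a' b'] /= -[/eqP + /eqP].
      by rewrite !eqr_nat => /eqP/val_inj-> /eqP/val_inj->.
    - by move=> j; rewrite mulrBl; apply: gaussian_intD => //; exact: gaussian_intN.
    - by rewrite mulrBl; apply: gaussian_intD => //; exact: gaussian_intN.
  have close (a b : 'I_M.+1) : (a %/ m = b %/ m)%N -> `|a%:R - b%:R| <= 2 ^+ i :> R.
    move=> ab; rewrite -natrX -/m.
    rewrite (divn_eq a m) (divn_eq b m) ab !natrD opprD addrACA subrr add0r.
    have := ltn_pmod a m0; have := ltn_pmod b m0.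
    rewrite -!(ltr_nat R) => h1 h2.
    have h3 : 0 <= (a %% m)%:R :> R by []. have h4 : 0 <= (b %% m)%:R :> R by [].
    by rewrite ler_norml; apply/andP; split; lra.
  have c1 := close _ _ e1; have c2 := close _ _ e2.
  have p0 : 0 < 2 ^+ i :> R by rewrite exprn_gt0.
  rewrite le_cmod; last by rewrite mulr_ge0// ltW.
  rewrite /=; move: c1 c2; rewrite !ler_norml.
  move: (2 ^+ i : R) p0 => p p0 /andP[h1 h2] /andP[h3 h4]; nra.
rewrite -(card_in_imset g_inj); apply: leq_trans (max_card _) _.
by rewrite card_prod !card_ord -expnMn.
Qed.

Let tau i := #|[set t in S | f t \in low_points i]%SET|.

Let layer i : {fset coords} := (low_points i.+1 `\` low_points i)%fset.

(** A point in level i+1 but not in level i has at most 4^(k-i) parameters, and level i+1 has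
    O(4^((i+1)(n+1))) points. The products grow by the factor 4^n >= 2 with i, so the last one
    controls the sum. *)
Lemma card_tau i : (i <= k)%N ->
  (tau i)%:R <= low_const * 4 ^+ n.+1 * 4 ^+ k * (4 ^+ i) ^+ n :> R.
Proof.
have L0 := low_const_gt0.
elim: i => [_|i IH ik].
  apply: (@le_trans _ _ ((#|` low_points 0| * 4 ^ k)%:R)).
    rewrite ler_nat; apply: card_le_fibers => x _.
    by rewrite -[k in (4 ^ k)%N]subn0; apply: card_fiber => //; left.
  rewrite natrM natrX expr0 expr1n mulr1 ler_pM2r ?exprn_gt0//.
  apply: le_trans (card_low_points 0) _; rewrite expr0 expr1n mulr1.
  by apply: ler_peMr; [exact: ltW|rewrite exprn_ege1// ler1n].
apply: (@le_trans _ _ ((tau i + #|` low_points i.+1| * 4 ^ (k - i))%:R)).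
  rewrite ler_nat; apply: (@leq_trans (tau i + #|[set t in S | f t \in layer i]%SET|)).
    apply: leq_trans (leq_card_setU _ _); apply/subset_leq_card/fintype.subsetP => t.
    rewrite !inE => /andP[tS ti]; rewrite tS ti /= andbT.
    by case: (f t \in low_points i).
  rewrite leq_add2l; apply: (@leq_trans (#|` layer i| * 4 ^ (k - i))).
    apply: card_le_fibers => x; rewrite in_fsetD => /andP[xi xi1].
    apply: card_fiber; first exact: ltnW.
    right => bx; move/negP: xi; apply; apply/in_low_points; split => //.
    by have /in_low_points[] := xi1.
  by rewrite leq_mul2r fsubset_leq_card ?orbT// fsubsetDl.
rewrite natrD natrM natrX.
apply: (@le_trans _ _ (low_const * 4 ^+ n.+1 * 4 ^+ k * (4 ^+ i) ^+ n +
    low_const * (4 ^+ i.+1) ^+ n.+1 * 4 ^+ (k - i))).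
  rewrite lerD ?IH ?(ltnW ik)// ler_pM2r ?exprn_gt0//; exact: card_low_points.
have -> : low_const * (4 ^+ i.+1) ^+ n.+1 * 4 ^+ (k - i) =
    low_const * 4 ^+ n.+1 * 4 ^+ k * (4 ^+ i) ^+ n.
  rewrite -[in RHS](subnK (ltnW ik)) exprD.
  rewrite [4 ^+ i.+1]exprS exprMn [(4 ^+ i) ^+ n.+1]exprS; ring.
rewrite [4 ^+ i.+1]exprS exprMn.
have : 2 <= 4 ^+ n :> R.
  rewrite -(prednK n_gt0) exprS; have : 1 <= 4 ^+ n.-1 :> R by rewrite exprn_ege1// ler1n.
  lra.
have : 0 < low_const * 4 ^+ n.+1 * 4 ^+ k * (4 ^+ i) ^+ n.
  by do 3! (apply: mulr_gt0; last by do ?apply: exprn_gt0).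
rewrite [4 ^+ n * _]mulrC mulrA.
move: (_ * _ * _ * _) (4 ^+ n) => u v u0 v2; nra.
Qed.

Lemma card_domain : (48 <= M)%N -> (4 ^+ k) ^+ n.+1 <= 16 * #|S|%:R :> R.
Proof.
move=> M48; have K2 : (M.+1 ^ 2 = 4 ^ k)%N by rewrite MK -expnM mulnC expnM.
have -> : #|S| = (#|coprime_pairs M| * (4 ^ k) ^ n)%N.
  rewrite (_ : S = finset.setX (coprime_pairs M) finset.setT); last first.
    by apply/setP => -[a b]; rewrite !inE andbT.
  by rewrite cardsX cardsT card_ffun card_prod !card_ord -K2.
rewrite -!natrX -natrM ler_nat mulnA expnS leq_mul2r -K2.
by rewrite card_coprime_pairs ?orbT.
Qed.

Lemma assigned_low (t : T) : t \in S -> f t \in low_points k.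
Proof.
move=> /fP[dq ho _]; apply/in_low_points; split => //; exists (q t) => //.
have lt (a : 'I_M.+1) : (0 : R) <= a%:R <= (2 : R) ^+ k.
  by rewrite ler0n /= -natrX -MK ler_nat ltnW.
rewrite le_cmod; last by rewrite mulr_ge0// exprn_ge0.
rewrite /=; have := lt t.1.1; have := lt t.1.2.
by move: (2 ^+ k : R) => p /andP[h1 h2] /andP[h3 h4]; nra.
Qed.

(** Of at least 1/16 of (4^k)^(n+1) parameters, at most 1/32 give points of level k - J. The others
    have fibres of size at most 4^J, so the remaining 1/32 forces many distinct points. *)
Lemma card_low_points_scale J : (48 <= M)%N -> (J <= k)%N ->
  32 * (low_const * 4 ^+ n.+1) <= 4 ^+ J ->
  (4 ^+ k) ^+ n.+1 <= 32 * 4 ^+ J * #|` low_points k|%:R :> R.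
Proof.
move=> M48 Jk hJ.
have SE : (#|S| <= tau (k - J) + #|` low_points k| * 4 ^ J)%N.
  pose Y := (low_points k `\` low_points (k - J))%fset.
  apply: (@leq_trans (tau (k - J) + #|[set t in S | f t \in Y]%SET|)).
    apply: leq_trans (leq_card_setU _ _); apply/subset_leq_card/fintype.subsetP => t tS.
    have tk := assigned_low tS; rewrite !inE in tS *; rewrite tS tk /= andbT.
    by case: (f t \in _).
  rewrite leq_add2l; apply: (@leq_trans (#|` Y| * 4 ^ J)).
    apply: card_le_fibers => x; rewrite in_fsetD => /andP[xJ xk].
    rewrite -[J in (4 ^ J)%N](subKn Jk); apply: card_fiber; first exact: leq_subr.
    right => bx; move/negP: xJ; apply; apply/in_low_points; split => //.
    by have /in_low_points[] := xk.
  by rewrite leq_mul2r fsubset_leq_card ?orbT// fsubsetDl.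
have h1 := card_domain M48; have h2 := card_tau (leq_subr J k).
move: SE; rewrite -(ler_nat R) natrD natrM natrX => h3.
have h4 : low_const * 4 ^+ n.+1 * 4 ^+ k * (4 ^+ (k - J)) ^+ n <=
    32^-1 * (4 ^+ k) ^+ n.+1.
  apply: (@le_trans _ _ (32^-1 * 4 ^+ J * 4 ^+ k * (4 ^+ (k - J)) ^+ n)).
    by rewrite !ler_pM2r ?exprn_gt0//; lra.
  (* This reduces to 4^J <= (4^J)^n, where the dimension has to be at least 1. *)
  rewrite -!mulrA ler_pM2l ?invr_gt0// exprS mulrCA ler_pM2l ?exprn_gt0//.
  rewrite -[X in _ <= (4 ^+ X) ^+ _](subnKC Jk) exprD exprMn.
  rewrite ler_pM2r ?exprn_gt0// ler_eXnr//.
  by rewrite exprn_ege1// ler1n.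
have {}h3 := le_trans h3 (lerD (le_trans h2 h4) (lexx _)).
move: (_ ^+ n.+1) (#|S|%:R) (#|` low_points k|%:R) (4 ^+ J) h1 h3 => a b c d h1 h3.
lra.
Qed.

End Scale.

Lemma card_low_points_ge : exists2 c : R, 0 < c &
  exists k0, forall k, (k0 <= k)%N -> c * (4 ^+ k) ^+ n.+1 <= #|` low_points k|%:R.
Proof.
pose A := 32 * (low_const * 4 ^+ n.+1); pose J := Num.truncn A.
have hJ : A <= 4 ^+ J.+1.
  apply: (@le_trans _ _ J.+1%:R); first by rewrite ltW// truncnS_gt.
  by rewrite -natrX ler_nat ltnW// ltn_expl.
exists (32 * 4 ^+ J.+1)^-1; first by rewrite invr_gt0 mulr_gt0// exprn_gt0.
(* The 6 guarantees 2^k >= 64, hence M >= 48, and the rest guarantees J.+1 <= k. *)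
exists (6 + J.+1)%N => k hk.
have [M MK] : exists M, M.+1 = (2 ^ k)%N by exists (2 ^ k).-1; rewrite prednK ?expn_gt0.
have M48 : (48 <= M)%N.
  have : (2 ^ 6 <= 2 ^ k)%N by rewrite leq_exp2l//; lia.
  by rewrite -MK; lia.
have [f fP] := choice (@exists_assigned M).
have := card_low_points_scale MK fP M48 _ hJ.
move=> /(_ ltac:(lia)) h; rewrite mulrC ler_pdivrMr; first by rewrite mulrC.
by rewrite mulr_gt0// exprn_gt0.
Qed.

End Counting.

(** * Bonferroni's inequality *)

Section Bonferroni.
Context d (T : measurableType d) (R : realType).
Variable mu : {measure set T -> \bar R}.

Lemma measure_bigsetU_sub (A : set T) (E : nat -> set T) (b : R) m :
  measurable A -> (forall k, measurable (E k)) ->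
  (forall k, (k < m)%N -> (mu (E k `&` A) <= b%:E)%E) ->
  (mu (\big[setU/set0]_(k < m) E k `&` A) <= (m%:R * b)%:E)%E.
Proof.
move=> mA mE; elim: m => [|m IH] h; first by rewrite big_ord0 set0I measure0 mul0r.
rewrite big_ord_recr /= setIUl.
have mU : measurable (\big[setU/set0]_(k < m) E k) by exact: bigsetU_measurable.
have mX : measurable (\big[setU/set0]_(k < m) E k `&` A) by exact: measurableI.
have mY : measurable (E m `&` A) by exact: measurableI.
apply: le_trans (measureU2 _ mX mY) _.
rewrite -natr1 mulrDl mul1r EFinD; apply: leeD; last exact: h.
by apply: IH => k km; apply: h; exact: ltnW.
Qed.

(** Adding the set of index m gains at least a - m b, because its overlap with the earlier sets is
    at most m b. The number of pairs is bounded crudely by m^2. *)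
Lemma bonferroni (E : nat -> set T) (a b : R) m : 0 <= b ->
  (forall k, measurable (E k)) ->
  (forall k, (k < m)%N -> (a%:E <= mu (E k))%E) ->
  (forall j k, (j < k)%N -> (mu (E j `&` E k) <= b%:E)%E) ->
  ((m%:R * a - m%:R ^+ 2 * b)%:E <= mu (\big[setU/set0]_(k < m) E k))%E.
Proof.
move=> b0 mE ha hb; elim: m ha => [|m IH] ha.
  by rewrite big_ord0 measure0 expr0n !mul0r subrr.
rewrite big_ord_recr /=; set U := \big[setU/set0]_(k < m) E k.
have mU : measurable U by exact: bigsetU_measurable.
have -> : U `|` E m = U `|` (E m `\` U).
  apply/seteqP; split=> x [Ux|]; [by left| |by left|by case; right].
  by have [Ux|nUx] := pselect (U x); [left|right].
rewrite measureU//; [|exact: measurableD|by rewrite setDIK].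
have hE : (a%:E <= mu (E m `\` U) + (m%:R * b)%:E)%E.
  apply: le_trans (ha m (ltnSn m)) _.
  rewrite (measureDI mu (mE m) mU) leeD2l// setIC.
  by apply: measure_bigsetU_sub => // k km; exact: hb.
have {}hE : ((a - m%:R * b)%:E <= mu (E m `\` U))%E.
  by rewrite EFinB leeBlDr.
have := leeD (IH (fun k km => ha k (ltnW km))) hE.
apply: le_trans; rewrite -EFinD lee_fin -natr1.
have : 0 <= m%:R :> R by [].
nra.
Qed.
End Bonferroni.

(** * A lower bound, uniform in the constant, for the measure of points near rationals *)

Section PositiveMeasure.
Context (R : realType) (n : nat).
Local Notation plane := (measurableTypeR R * measurableTypeR R)%type.
Local Notation coords := (n.-tuple plane * measurableTypeR R)%type.
Implicit Types x y h : coords.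
Hypothesis n_gt0 : (0 < n)%N.

Let rad : R := radius R n.
Let o : coords := origin R n.

(** The radius depends on an integer bound for the denominator, which makes the set a countable
    union of finite unions of balls; it still forces a squared distance below e/|q|^2. *)
Definition near_rat (e : R) : set coords :=
  [set h | exists (N : nat) x, bounded_denom N.+1%:R x /\
    gauge2 x h < e / N.+1%:R ^+ 2].

Lemma near_rat_le (e e' : R) : e <= e' -> near_rat e `<=` near_rat e'.
Proof.
move=> ee h [N [x [Nx xh]]]; exists N, x; split => //; apply: lt_le_trans xh _.
by rewrite ler_wpM2r// invr_ge0 exprn_ge0.
Qed.

Lemma measurable_near_rat e : measurable (near_rat e).
Proof.
rewrite (_ : near_rat e = \bigcup_N \bigcup_m
    gballs (fratpts o N.+1%:R m%:R) (e / N.+1%:R ^+ 2)).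
  by apply: bigcupT_measurable => N; apply: bigcupT_measurable => m; exact: measurable_gballs.
apply/seteqP; split => h.
  move=> [N [x [Nx xh]]]; exists N => //; exists (Num.truncn (gauge2 o x)).+1 => //.
  by exists x => //=; apply/in_fratpts; rewrite // ltW// truncnS_gt.
move=> [N _ [m _ [x /= /in_fratpts xN xh]]]; exists N, x; split => //.
by have [] := xN n_gt0 (ltr0Sn _ _) (ler0n _ _).
Qed.

Let E (eta : R) (k : nat) : set coords :=
  gballs (low_points R n k) (eta / (4 * 4 ^+ k)).

Let four k : (2 * 2 ^+ k) ^+ 2 = 4 * 4 ^+ k :> R.
Proof. by rewrite exprMn exprAC -!natrX. Qed.

Let E_near eta k : E eta k `<=` near_rat eta.
Proof.
move=> h [x /= xk xh].
have [dx ox] := (in_low_points n_gt0 k x).1 xk.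
have NE : (2 * 2 ^ k).-1.+1%:R = 2 * 2 ^+ k :> R.
  by rewrite prednK ?muln_gt0 ?expn_gt0// natrM natrX.
by exists (2 * 2 ^ k).-1, x; rewrite NE four.
Qed.

Let E_bounded eta k : 0 <= eta -> eta <= 1 -> E eta k `<=` gball o (2 * (rad + 1)).
Proof.
move=> e0 e1 h [x /= xk xh]; rewrite /gball /=.
have [dx ox] := (in_low_points n_gt0 k x).1 xk.
apply: le_lt_trans (gauge2_tri x o h) _; rewrite ltr_pM2l// ler_ltD//.
apply: lt_le_trans xh _; rewrite ler_pdivrMr ?mulr_gt0 ?exprn_gt0//.
have : 1 <= 4 ^+ k :> R by rewrite exprn_ege1// ler1n.
by rewrite mul1r; lra.
Qed.

Let measurable_E eta k : measurable (E eta k).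
Proof. exact: measurable_gballs. Qed.

(** The bound 1/4 on [eta] makes the balls disjoint, so the measure is at least the number of points
    times the least volume of a ball. *)
Let haar_E_ge (c eta : R) k : 0 < eta -> eta <= 4^-1 ->
  c * (4 ^+ k) ^+ n.+1 <= #|` low_points R n k|%:R ->
  ((c * vol_lb R n * 4^-1 ^+ n.+1 * eta ^+ n.+1)%:E <= haar R n (E eta k))%E.
Proof.
move=> e0 e4 hc; have p0 : 0 < 4 ^+ k :> R by rewrite exprn_gt0.
have Q0 : 0 < 2 * 2 ^+ k :> R by rewrite mulr_gt0 ?exprn_gt0.
have t0 : 0 < eta / (4 * 4 ^+ k) by rewrite divr_gt0// mulr_gt0.
have tQ : eta / (4 * 4 ^+ k) <= (4 * (2 * 2 ^+ k) ^+ 2)^-1.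
  by rewrite four ler_pdivrMr ?mulr_gt0// invfM mulfVK ?gt_eqF ?mulr_gt0.
apply: le_trans (haar_gballs_ge n_gt0 Q0 t0 tQ _); last first.
  by move=> x /(in_low_points n_gt0)[].
rewrite lee_fin; apply: (@le_trans _ _ (c * (4 ^+ k) ^+ n.+1 *
    (vol_lb R n * (eta / (4 * 4 ^+ k)) ^+ n.+1))).
  rewrite expr_div_n exprMn exprVn.
  have q0 : 0 < (4 ^+ k) ^+ n.+1 :> R by rewrite exprn_gt0.
  have r0 : 0 < 4 ^+ n.+1 :> R by rewrite exprn_gt0.
  rewrite le_eqVlt; apply/predU1P; left; move: ((4 ^+ k) ^+ n.+1) (4 ^+ n.+1) (eta ^+ n.+1) q0 r0 => u v w u0 v0.
  by field; rewrite !gt_eqF.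
by rewrite ler_pM2r// mulr_gt0 ?vol_lb_gt0// exprn_gt0.
Qed.

Let quasi : R := low_const R n * pack R n * vol_ub R n * (5 / 4) ^+ n.+1.

Let quasi_gt0 : 0 < quasi.
Proof.
have l0 := low_const_gt0 R n_gt0; have p0 := pack_gt0 R n_gt0.
by rewrite mulr_gt0 ?exprn_gt0 ?divr_gt0// mulr_gt0 ?vol_ub_gt0// mulr_gt0.
Qed.

(* The points of the finer scale whose balls meet a given ball of the coarser
   scale lie in a slightly larger ball, where packing bounds their number. *)
Let haar_EI_le (eta : R) k l : 0 < eta -> (k <= l)%N -> 1 <= eta * 4 ^+ (l - k) ->
  (haar R n (E eta k `&` E eta l) <= (quasi * eta ^+ n.+1 ^+ 2)%:E)%E.
Proof.
move=> e0 kl gap.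
have pk : 0 < 4 ^+ k :> R by rewrite exprn_gt0.
have pl : 0 < 4 ^+ l :> R by rewrite exprn_gt0.
have lE : 4 ^+ l = 4 ^+ k * 4 ^+ (l - k) :> R by rewrite -exprD subnKC.
pose t := eta / (4 * 4 ^+ l).
have t0 : 0 < t by rewrite divr_gt0// mulr_gt0.
have Q0 : 0 < 2 * 2 ^+ l :> R by rewrite mulr_gt0 ?exprn_gt0.
pose Z x := fratpts x (2 * 2 ^+ l) (eta / 4 ^+ k).
have s0 : 0 <= eta / 4 ^+ k by rewrite ltW// divr_gt0.
have sub : E eta k `&` E eta l `<=`
    \bigcup_(x in [set` low_points R n k]) gballs (Z x) t.
  move=> h [[x /= xk xh] [y /= yl yh]]; exists x => //; exists y => //=.
  have [dy oy] := (in_low_points n_gt0 l y).1 yl.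
  apply/(in_fratpts n_gt0 x y Q0 s0); split => //.
  apply: le_trans (gauge2_tri h x y) _; rewrite (gauge2_sym h y).
  have : t <= eta / (4 * 4 ^+ k).
    rewrite ler_pM2l// lef_pV2 ?posrE ?mulr_gt0// ler_pM2l//.
    by rewrite ler_weXn2l// ler1n.
  (* The coarse radius dominates the fine one, so the quasi-triangle inequality costs a factor 4. *)
  have -> : eta / 4 ^+ k = 4 * (eta / (4 * 4 ^+ k)).
    by field; rewrite gt_eqF.
  by move: xh yh; rewrite /gball /= -/t; lra.
have card_Z x : #|` Z x|%:R <= pack R n * (5 * eta * 4 ^+ (l - k)) ^+ n.+1.
  apply: (le_trans (card_fratpts n_gt0 x Q0 s0)).
  rewrite ler_pM2l ?pack_gt0// four lE.
  have -> : 4 * (4 ^+ k * 4 ^+ (l - k)) * (eta / 4 ^+ k) = 4 * (eta * 4 ^+ (l - k)).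
    by field; rewrite gt_eqF.
  (* The gap between the scales absorbs the additive 1 of the packing bound, turning 4 into 5. *)
  by rewrite lerXn2r ?nnegrE//; lra.
apply: (@le_trans _ _ (\sum_(x \in [set` low_points R n k]) haar R n (gballs (Z x) t))%E).
  apply: content_sub_fsum => //.
  - by move=> x _; exact: measurable_gballs.
  - by apply: measurableI; exact: measurable_E.
rewrite -fsbig_seq ?fset_uniq//.
apply: (@le_trans _ _ (\sum_(x <- low_points R n k) (pack R n *
    (5 * eta * 4 ^+ (l - k)) ^+ n.+1 * (vol_ub R n * t ^+ n.+1))%:E)%E).
  apply: lee_sum => x _; apply: le_trans (haar_gballs_le _ (ltW t0)) _.
  by rewrite lee_fin ler_pM2r// mulr_gt0 ?vol_ub_gt0// exprn_gt0.
rewrite sumEFin big_const_seq count_predT iter_addr_0 lee_fin -[leLHS]mulr_natl.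
apply: (@le_trans _ _ (low_const R n * (4 ^+ k) ^+ n.+1 * (pack R n *
    (5 * eta * 4 ^+ (l - k)) ^+ n.+1 * (vol_ub R n * t ^+ n.+1)))).
  rewrite ler_pM2r; first exact: card_low_points.
  have p0 := pack_gt0 R n_gt0; have v0 := vol_ub_gt0 R n.
  have g0 : 0 < 5 * eta * 4 ^+ (l - k) by rewrite mulr_gt0 ?exprn_gt0// mulr_gt0.
  by rewrite mulr_gt0// mulr_gt0// exprn_gt0.
rewrite le_eqVlt; apply/predU1P; left; rewrite /quasi [eta ^+ _ ^+ 2]exprAC.
have -> : low_const R n * (4 ^+ k) ^+ n.+1 * (pack R n *
    (5 * eta * 4 ^+ (l - k)) ^+ n.+1 * (vol_ub R n * t ^+ n.+1)) =
  low_const R n * pack R n * vol_ub R n *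
    (4 ^+ k * (5 * eta * 4 ^+ (l - k)) * t) ^+ n.+1.
  rewrite !exprMn; ring.
rewrite -[RHS]mulrA -exprMn; congr (_ * _ ^+ _).
by rewrite /t lE; field; rewrite !gt_eqF ?exprn_gt0.
Qed.

(** With theta = eta^(n+1), [m] scales give at least m theta (a - quasi m theta). Choosing m theta
    between a/(4 quasi) and a/(2 quasi) gives a^2/(8 quasi), whatever [e] is. *)
Lemma near_rat_bounded_measure : exists2 delta : R, 0 < delta &
  forall e, 0 < e ->
    (delta%:E <= haar R n (near_rat e `&` gball o (2 * (rad + 1))))%E.
Proof.
have [c c0 [k0 hc]] := card_low_points_ge R n_gt0.
pose a := c * vol_lb R n * 4^-1 ^+ n.+1.
have a0 : 0 < a by rewrite !mulr_gt0 ?vol_lb_gt0// exprn_gt0.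
have q0 := quasi_gt0.
exists (a ^+ 2 / (8 * quasi)); first by rewrite divr_gt0 ?exprn_gt0// mulr_gt0.
move=> e e0.
(* Taking eta = 4^(-s) lets scales [s] apart satisfy the gap condition; the bound a/(2 quasi) will
   allow at least one scale. *)
have [eta [s [eta0 eta_e eta4 etaq etas]]] : exists (eta : R) (s : nat),
    [/\ 0 < eta, eta <= e, eta <= 4^-1, eta <= a / (2 * quasi) & 1 <= eta * 4 ^+ s].
  pose m := Num.min e (Num.min 4^-1 (a / (2 * quasi))).
  have m0 : 0 < m.
    have i4 : 0 < 4^-1 :> R by lra.
    by rewrite /m !lt_min e0 i4 /=; apply: divr_gt0 => //; exact: mulr_gt0.
  pose s := (Num.truncn m^-1).+1.
  have sm : 4 ^- s <= m.
    rewrite -[leRHS]invrK lef_pV2 ?posrE ?invr_gt0 ?exprn_gt0//.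
    apply: (@le_trans _ _ s%:R); first by rewrite ltW// truncnS_gt.
    by rewrite -natrX ler_nat ltnW// ltn_expl.
  exists (4 ^- s), s; rewrite mulVf ?expf_neq0 ?pnatr_eq0// invr_gt0 exprn_gt0//.
  by move: sm; rewrite !le_min => /and3P[-> -> ->].
pose theta := eta ^+ n.+1.
have th0 : 0 < theta by rewrite exprn_gt0.
have th_eta : theta <= eta.
  rewrite /theta exprS; apply: ler_piMr; first exact: ltW.
  by apply: exprn_ile1; lra.
pose y := a / (2 * quasi * theta).
have y1 : 1 <= y.
  have qt : 0 < 2 * quasi * theta by apply: mulr_gt0 => //; exact: mulr_gt0.
  rewrite /y ler_pdivlMr// mul1r mulrC -ler_pdivlMr; last exact: mulr_gt0.
  exact: le_trans etaq.
(* As y >= 1, truncation loses at most a factor 2. *)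
pose m := Num.truncn y.
have /andP[my ym] : m%:R <= y < m.+1%:R by apply: truncn_itv; lra.
have m1 : 1 <= m%:R :> R by rewrite ler1n truncn_gt0.
rewrite -natr1 in ym.
have yth : y * theta = a / (2 * quasi).
  by rewrite /y; field; rewrite !gt_eqF.
pose F i := E eta (k0 + s * i)%N.
have hF : (((m%:R * (a * theta) - m%:R ^+ 2 * (quasi * theta ^+ 2))%:E <=
    haar R n (\big[setU/set0]_(i < m) F i)))%E.
  apply: bonferroni.
  - by apply: mulr_ge0; [exact: ltW|exact: sqr_ge0].
  - by move=> i; exact: measurable_E.
  - by move=> i _; apply: haar_E_ge => //; apply: hc; exact: leq_addr.
  - move=> i j ij; apply: haar_EI_le => //.
      by rewrite leq_add2l leq_mul2l ltnW ?orbT.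
    apply: le_trans etas _; rewrite ler_pM2l//; apply: ler_weXn2l; first by rewrite ler1n.
    by rewrite subnDl -mulnBr leq_pmulr// subn_gt0.
have sub : \big[setU/set0]_(i < m) F i `<=` near_rat e `&` gball o (2 * (rad + 1)).
  rewrite -bigcup_mkord => h [i _ hi]; split.
    exact/(near_rat_le eta_e)/(E_near hi).
  by apply: E_bounded hi; [exact: ltW|lra].
apply: (@le_trans _ _ (haar R n (\big[setU/set0]_(i < m) F i))); last first.
  apply: le_measure => //; rewrite inE.
  - by apply: bigsetU_measurable => i _; exact: measurable_E.
  - by apply: measurableI; [exact: measurable_near_rat|exact: measurable_gball].
apply: le_trans hF; rewrite lee_fin.
have h1 : m%:R * theta <= a / (2 * quasi) by rewrite -yth ler_pM2r.
have h2 : a / (4 * quasi) <= m%:R * theta.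
  have -> : a / (4 * quasi) = y * theta / 2 by rewrite yth; field; rewrite gt_eqF.
  have : y <= 2 * m%:R by lra.
  by rewrite -(ler_pM2r th0); lra.
have -> : a ^+ 2 / (8 * quasi) = a / (4 * quasi) * (a / 2) by field; rewrite gt_eqF.
have -> : m%:R * (a * theta) - m%:R ^+ 2 * (quasi * theta ^+ 2) =
  m%:R * theta * (a - quasi * (m%:R * theta)) by ring.
apply: ler_pM => //; [by rewrite ltW// divr_gt0// mulr_gt0|by rewrite ltW// divr_gt0|].
have : quasi * (m%:R * theta) <= quasi * (a / (2 * quasi)) by rewrite ler_pM2l.
have -> : quasi * (a / (2 * quasi)) = a / 2 by field; rewrite gt_eqF.
lra.
Qed.

End PositiveMeasure.

(** * The full-measure set of well approximable points *)

Lemma pos_lower_bound (R : realType) (T : eqType) (s : seq T) (f : T -> R) :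
  (forall y, y \in s -> 0 < f y) ->
  exists2 e, 0 < e & forall y, y \in s -> e <= f y.
Proof.
elim: s => [|z s IH] pos; first by exists 1.
have [y ys|e e0 he] := IH; first by apply: pos; rewrite inE ys orbT.
exists (Num.min e (f z)); first by rewrite lt_min e0 pos// inE eqxx.
by move=> y; rewrite inE ge_min => /orP[/eqP ->|/he ->//]; rewrite lexx orbT.
Qed.

Section WellApproximable.
Context (R : realType) (n : nat).
Local Notation plane := (measurableTypeR R * measurableTypeR R)%type.
Local Notation coords := (n.-tuple plane * measurableTypeR R)%type.
Implicit Types x y h : coords.

Hypothesis n_gt0 : (0 < n)%N.

Definition well_approx : set coords := \bigcap_m @near_rat R n m.+1%:R^-1.

(** The product D q is a denominator of the translate: since [D] is real, it can be moved under the
    conjugation in [hdot] to clear the coordinates of [g]. *)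
Lemma ltrans_bounded_denom g (D N : nat) x : (0 < D)%N ->
  (forall j, gaussian_int (D%:R * chart_u g 0 j)) ->
  gaussian_int (D%:R * (chart g).2) ->
  bounded_denom N.+1%:R x -> bounded_denom (D * N.+1)%:R (ltrans g x).
Proof.
move=> D0 Zu Zv [q [Zq q0 Zqu Zqv] qN].
have DR : D%:R != 0 :> R[i] by rewrite pnatr_eq0 -lt0n.
have ZD : gaussian_int (D%:R : R[i]).
  by exists D%:Z, 0; apply/eqP; rewrite eq_complex /= raddfMn /= raddfMn /= mul0rn !eqxx.
have conjD : conjc (D%:R : R[i]) = D%:R by exact: conjc_nat.
exists (D%:R * q).
  have E := chart_ltrans g x.
  split.
  - exact: gaussian_intM.
  - by rewrite mulf_neq0.
  - move=> j; have -> : chart_u (ltrans g x) = chart_u g + chart_u x by case: E.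
    rewrite mxE mulrDr; apply: gaussian_intD.
      by rewrite mulrAC [_ * q]mulrC; exact: gaussian_intM.
    by rewrite -mulrA; exact: gaussian_intM.
  - have -> : D%:R * q * (chart (ltrans g x)).2 = D%:R * (chart g).2 * q +
        D%:R * (q * (chart x).2) + D%:R * q * hdot (chart_u g) (chart_u x).
      rewrite E; change (chart_u g) with (chart g).1; change (chart_u x) with (chart x).1.
      by move: (chart g) (chart x) => [u v] [u' v'] /=; ring.
    apply: gaussian_intD; first apply: gaussian_intD.
    + exact: gaussian_intM.
    + exact: gaussian_intM.
    + rewrite /hdot mulr_sumr; apply: gaussian_int_sum => j.
      rewrite (_ : _ * _ = conjc (D%:R * chart_u g 0 j) * (q * chart_u x 0 j)).
        by apply: gaussian_intM => //; exact: gaussian_int_conj.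
      by rewrite rmorphM /= conjD; ring.
rewrite cmodM natrM ler_pM ?cmod_ge0//.
have -> : (D%:R : R[i]) = D%:R%:C by rewrite rmorph_nat.
by rewrite /= expr0n addr0 sqrtr_sqr ger0_norm.
Qed.

(** Translation preserves distances and multiplies denominators by [D], so approximating [h] with a
    constant smaller by the factor D^2 compensates. *)
Lemma well_approx_ltrans g (D : nat) h : (0 < D)%N ->
  (forall j, gaussian_int (D%:R * chart_u g 0 j)) ->
  gaussian_int (D%:R * (chart g).2) ->
  well_approx h -> well_approx (ltrans g h).
Proof.
move=> D0 Zu Zv wh m _; pose m' := (m.+1 * D ^ 2).-1.
have m'E : m'.+1 = (m.+1 * D ^ 2)%N by rewrite prednK// muln_gt0 /= expn_gt0 D0.
have [N [x [Nx xh]]] := wh m' I.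
have NE : (D * N.+1).-1.+1 = (D * N.+1)%N by rewrite prednK// muln_gt0 D0.
exists (D * N.+1).-1, (ltrans g x); rewrite NE gauge2_ltrans; split.
  exact: ltrans_bounded_denom.
apply: lt_le_trans xh _; rewrite m'E [(m.+1 * _)%:R]natrM natrX [(D * _)%:R]natrM.
have DR : D%:R != 0 :> R by rewrite pnatr_eq0 -lt0n.
rewrite le_eqVlt; apply/predU1P; left.
by field; rewrite DR !nat1r !pnatr_eq0.
Qed.

Lemma well_approx_vertical (M : nat) (a : int) s (y : R) : (0 < M)%N ->
  well_approx (s, y) -> well_approx (s, y + a%:~R / M%:R).
Proof.
move=> M0 wy; pose g : coords := ([tuple (0, 0) | _ < n], a%:~R / M%:R).
have -> : (s, y + a%:~R / M%:R) = ltrans g (s, y).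
  rewrite /ltrans /g /= /symp big1 ?addr0; last first.
    by move=> j _; rewrite tnth_mktuple /= !mul0r subr0.
  congr (_, _); last by rewrite addrC.
  apply: eq_from_tnth => j; rewrite !tnth_mktuple /= !add0r.
  by case: (tnth s j).
have u0 j : chart_u g 0 j = 0 by rewrite mxE tnth_mktuple.
apply: (well_approx_ltrans (D := M)) => //.
  by move=> j; rewrite u0 mulr0; exact: gaussian_int0.
exists 0, a; rewrite /= /sqnorm big1; last first.
  by move=> j _; rewrite u0 ComplexField.Normc.normc0 expr0n.
have -> : (M%:R : R[i]) = M%:R%:C by rewrite rmorph_nat.
have MR : M%:R != 0 :> R by rewrite pnatr_eq0 -lt0n.
by apply/eqP; rewrite eq_complex /=; apply/andP; split; apply/eqP; field.
Qed.

Let grid_point (M : nat) (a : n.-tuple (int * int)) : n.-tuple plane :=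
  [tuple ((tnth a j).1%:~R / M%:R, (tnth a j).2%:~R / M%:R) | j < n].

Lemma well_approx_horizontal (M : nat) a s (y : R) : (0 < M)%N ->
  well_approx (s, y) ->
  well_approx (tuple_shift M a s, y + symp (grid_point M a) s).
Proof.
move=> M0 wy; pose g : coords := (grid_point M a, 0).
have -> : (tuple_shift M a s, y + symp (grid_point M a) s) = ltrans g (s, y).
  rewrite /ltrans /g /= add0r; congr (_, _).
  apply: eq_from_tnth => j; rewrite !tnth_mktuple /grid_shift /=.
  by rewrite ![_ + _ / _]addrC.
have MR : M%:R != 0 :> R by rewrite pnatr_eq0 -lt0n.
have DE : ((2 * M ^ 2)%N%:R : R[i]) = (2 * M%:R ^+ 2)%:C.
  by rewrite -natrX -natrM rmorph_nat.
(* The real part of the last coordinate of [g] is half of a squared norm with denominator M^2. *)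
apply: (well_approx_ltrans (D := 2 * M ^ 2)) => //.
- by rewrite muln_gt0 expn_gt0 M0.
- move=> j; rewrite mxE tnth_mktuple DE /=.
  exists (2 * M%:Z * (tnth a j).1), (2 * M%:Z * (tnth a j).2).
  rewrite !rmorphM /=.
  by apply/eqP; rewrite eq_complex /=; apply/andP; split; apply/eqP; field.
- exists (\sum_j ((tnth a j).1 ^+ 2 + (tnth a j).2 ^+ 2)), 0.
  have SE : sqnorm (chart_u g) =
      (\sum_j ((tnth a j).1 ^+ 2 + (tnth a j).2 ^+ 2))%:~R / M%:R ^+ 2.
    rewrite sqnorm_chart_u rmorph_sum /= mulr_suml; apply: eq_bigr => j _.
    by rewrite tnth_mktuple /= rmorphD !rmorphXn /=; field.
  rewrite DE /= SE; apply/eqP; rewrite eq_complex /=.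
  by apply/andP; split; apply/eqP; [field|rewrite mulr0 mul0r addr0].
Qed.

Lemma measurable_well_approx : measurable well_approx.
Proof. by apply: bigcapT_measurable => m; exact: measurable_near_rat. Qed.

(** Vertical translations give the law on each fibre. A horizontal translation carries the fibre
    over [s] to another fibre by a shift constant on it, so the set of [s] with null fibre is
    invariant under rational shifts. *)
Lemma well_approx_zero_one :
  haar R n well_approx = 0%E \/ haar R n (~` well_approx) = 0%E.
Proof.
have mW := measurable_well_approx.
apply: prod_measure_zero_one => //.
  move=> s; apply: translation_zero_one; first exact: measurable_xsection.
  by move=> M a M0 y; rewrite xsectionE /=; exact: well_approx_vertical.
apply: power_zero_one; first exact: measurable_null_xsection.
move=> M a M0 s /= s0; pose c := symp (grid_point M a) s.
rewrite (_ : xsection _ _ = (fun t : R => t + - c) @^-1` xsection well_approx s).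
  rewrite [LHS]lebesgue_measure_translation//; exact: measurable_xsection.
pose b := [tuple (- (tnth a j).1, - (tnth a j).2) | j < n].
have bK : tuple_shift M b (tuple_shift M a s) = s.
  apply: eq_from_tnth => j; rewrite !tnth_mktuple /grid_shift /=.
  by rewrite !rmorphN !mulNr !addrK; case: (tnth s j).
have cE : symp (grid_point M b) (tuple_shift M a s) = - c.
  rewrite /c /symp -sumrN; apply: eq_bigr => j _.
  by rewrite !tnth_mktuple /grid_shift /= !rmorphN; ring.
apply/seteqP; split => y; rewrite !xsectionE /=.
  by move=> /(well_approx_horizontal b M0); rewrite bK cE.
by move=> /(well_approx_horizontal a M0); rewrite -/c subrK.
Qed.

(** Continuity from above: the sets decrease with [m], lie in a ball of finite measure, and have
    measure at least [delta]. *)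
Lemma haar_well_approx_gt0 : (0 < haar R n well_approx)%E.
Proof.
have [delta d0 hd] := near_rat_bounded_measure R n_gt0.
set K := gball _ _ in hd; have mK : measurable K by exact: measurable_gball.
pose F m := @near_rat R n m.+1%:R^-1 `&` K.
have mF m : measurable (F m).
  by apply: measurableI => //; exact: measurable_near_rat.
have WF : \bigcap_m F m = well_approx `&` K.
  apply/seteqP; split => [h Fh|h [Wh Kh] m _]; last by split => //; exact: Wh.
  by split; [move=> m _; have [] := Fh m I|have [] := Fh 0%N I].
have Koo : (haar R n K < +oo)%E.
  apply: le_lt_trans (ltry _); apply: haar_gball_le.
  by rewrite mulr_ge0// addr_ge0// radius_ge0.
have niF : nonincreasing_seq F.
  move=> m m' mm'; apply/subsetPset => h [Fh Kh]; split => //.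
  apply: near_rat_le Fh.
  by rewrite lef_pV2 ?posrE ?ltr0n// ler_nat.
have cF : (haar R n \o F) m @[m --> \oo] --> haar R n (\bigcap_m F m).
  apply: nonincreasing_cvg_mu => //.
  - apply: le_lt_trans Koo; apply: le_measure; rewrite ?inE//; exact: subIsetr.
  - by rewrite WF; apply: measurableI => //; exact: measurable_well_approx.
apply: (@lt_le_trans _ _ delta%:E); first by rewrite lte_fin.
apply: (@le_trans _ _ (haar R n (\bigcap_m F m))); last first.
  rewrite WF; apply: le_measure; rewrite ?inE; last exact: subIsetl.
  - by apply: measurableI => //; exact: measurable_well_approx.
  - exact: measurable_well_approx.
rewrite -(cvg_lim _ cF)//; apply: lime_ge; first by apply/cvg_ex; eexists; exact: cF.
by apply: nearW => m; apply: hd; rewrite invr_gt0.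
Qed.

Lemma haar_well_approxC : haar R n (~` well_approx) = 0%E.
Proof.
have [W0|//] := well_approx_zero_one.
by have := haar_well_approx_gt0; rewrite W0 ltxx.
Qed.

(** The point is not rational, so finitely many approximants would stay at squared distance at least
    some e > 0. Well-approximability with a constant below [e] produces a closer one. *)
Lemma infinite_approx x : (forall r : rat, x.2 != ratr r) ->
  well_approx x -> infinite_set (approx 1 x).
Proof.
move=> irr wx fin.
have pos y : approx 1 x y -> 0 < gauge2 x y.
  move=> [q dq _]; rewrite lt_def gauge2_ge0 andbT; apply/eqP => /gauge2_eq0 xy.
  have [_ _ [r [s /= [_ xs]]]] := denom_siegelQ dq.
  by have := irr s; rewrite xy xs eqxx.
have [e e0 he] : exists2 e : R, 0 < e & forall y, approx 1 x y -> e <= gauge2 x y.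
  have [X XE] := finite_fsetP.1 fin.
  have {}pos y : y \in X -> 0 < gauge2 x y by move=> yX; apply: pos; rewrite XE.
  have [e e0 he] := pos_lower_bound pos.
  by exists e => // y; rewrite XE; exact: he.
pose m := Num.truncn e^-1.
have me : m.+1%:R^-1 <= e.
  rewrite -[leRHS]invrK lef_pV2 ?posrE ?invr_gt0 ?ltr0n//.
  by apply/ltW/truncnS_gt.
have [N [y [[q dq qN] yx]]] := wx m I.
have [Zq q0 _ _] := dq; have q1 := cmod_gaussian_ge1 Zq q0.
have c0 : 0 < cmod q by apply: lt_le_trans q1.
have xy : gauge2 x y < m.+1%:R^-1 / cmod q ^+ 2.
  rewrite gauge2_sym; apply: lt_le_trans yx _.
  rewrite ler_pM2l ?invr_gt0 ?ltr0n// lef_pV2 ?posrE ?exprn_gt0//.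
  by rewrite lerXn2r ?nnegrE ?cmod_ge0.
have m1 : m.+1%:R^-1 <= 1 :> R by rewrite invf_le1 ?ltr0n// ler1n.
have q2 : 0 < (cmod q ^+ 2)^-1 by rewrite invr_gt0 exprn_gt0.
have q21 : (cmod q ^+ 2)^-1 <= 1 by rewrite invf_le1 ?exprn_gt0// exprn_ege1.
have m0 : 0 < m.+1%:R^-1 :> R by rewrite invr_gt0 ltr0n.
have ay : approx 1 x y.
  exists q => //; rewrite powR_inv1 ?cmod_ge0//.
  rewrite -ltr_sqr ?nnegrE ?sqrtr_ge0 ?invr_ge0 ?cmod_ge0//.
  rewrite sqr_sqrtr ?gauge2_ge0// exprVn; apply: lt_le_trans xy _.
  by rewrite ler_piMl// ltW.
(* Since |q| >= 1, dividing by |q|^2 only improves the bound. *)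
have : gauge2 x y < e.
  by apply: lt_le_trans xy _; apply: le_trans me; rewrite ler_piMr// ltW.
by rewrite ltNge he.
Qed.

Lemma measurable_rationals : measurable (range (@ratr R) : set (measurableTypeR R)).
Proof.
apply: countable_measurable => [t|]; first exact: measurable_set1.
by apply: sub_countable (card_image_le _ _) _.
Qed.

(** The rationals are Lebesgue-null in the vertical coordinate. *)
Lemma haar_rational_height :
  (haar R n).-negligible (setT `*` range (@ratr R)).
Proof.
apply/negligibleP; first by apply: measurableX => //; exact: measurable_rationals.
transitivity (power_measure (lebesgueC R) n setT * lebesgue_measure (range (@ratr R)))%E.
  by apply: product_measure1E => //; exact: measurable_rationals.
by rewrite lebesgue_measure_rat mule0.
Qed.

End WellApproximable.

Theorem theorem1p7 (R : realType) (n : nat) (n_ge1 : (1 <= n)%N) :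
  haar_ae (fun h : 'rV[R[i]]_n * R[i] =>
    infinite_set (approximants 1 h)) /\
  (forall alpha : R, 1 < alpha ->
     haar_null [set h : 'rV[R[i]]_n * R[i] |
       siegel h /\ infinite_set (approximants alpha h)]).
Proof.
(* Injectivity of [chart] lets solutions be counted in coordinates. *)
have inf alpha x : infinite_set (approximants alpha (chart x)) <->
    infinite_set (@approx R n alpha x).
  rewrite approximants_chart.
  by rewrite (eq_finite_set (inj_card_eq (in2W (@chart_inj R n)))).
split => [|alpha alpha1]; last first.
  by apply: negligibleS (approx_finite_ae n_ge1 alpha1) => x /= [_ /inf].
(* An exceptional point either is not well approximable or has a rational vertical coordinate. *)
apply: (@negligibleS _ _ _ _ (~` @well_approx R n `|` setT `*` range (@ratr R))).
  move=> x /= [_ fin]; have [wx|] := pselect (well_approx x); last by left.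
  right; split => //; apply: contrapT => irr; apply/fin/inf.
  apply: infinite_approx wx => r.
  by apply/eqP => xr; apply: irr; exists r.
apply: negligibleU; last exact: haar_rational_height.
apply/negligibleP; last exact: haar_well_approxC.
by apply: measurableC; exact: measurable_well_approx.
Qed.
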